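(* Let $q \ge 3$, $d \ge 3$ and $m \ge 3$, and let $\mathcal{X} \subset \mathbb{P}^m$ be a hypersurface of degree $d$ defined over $\mathbb{F}_q$ with $|\mathcal{X}(\mathbb{F}_q)| < dq^{m-1} + p_{m-2}$. Then: (a) if $3 \le d \le \frac{q+3}{2}$, then $|\mathcal{X}(\mathbb{F}_q)| \le dq^{m-1} + p_{m-2} - (d-2)q^{m-2}$, and equality holds only if $\mathcal{X}$ is a union of hyperplanes defined over $\mathbb{F}_q$; (b) if $\frac{q+3}{2} < d \le q$, then $|\mathcal{X}(\mathbb{F}_q)| \le (d-1)q^{m-1} + dq^{m-2} + p_{m-3} - (d-2)q^{m-3}$.
   Context: $\mathbb{F}_q$ is the finite field with $q$ elements. A projective hypersurface of degree $d$ defined over $\mathbb{F}_q$ is the zero set in $\mathbb{P}^m$ of a nonzero homogeneous polynomial of degree $d$ in $m+1$ variables over $\mathbb{F}_q$; $\mathcal{X}(\mathbb{F}_q)$ denotes its $\mathbb{F}_q$-rational points. $p_k = q^k + \dots + q + 1$ for $k \ge 0$. *)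

(* Defs.v *)
From HB Require Import structures.
From mathcomp Require Import all_boot all_algebra all_field.
From mathcomp Require Import mpoly.
Set Implicit Arguments. Unset Strict Implicit. Unset Printing Implicit Defensive.
Import GRing.Theory.
Local Open Scope ring_scope.

Definition pk (q k : nat) : nat := (\sum_(i < k.+1) q ^ i)%N.

Section Proj.
Variables (F : finFieldType) (m : nat).

Definition vecs := {ffun 'I_m.+1 -> F}.

Definition scalev (c : F) (x : vecs) : vecs := [ffun i => c * x i].

Definition proj_class (x : vecs) : {set vecs} :=
  [set scalev c x | c in [set c : F | c != 0]].

Definition proj_points : {set {set vecs}} :=
  [set proj_class x | x in [set x : vecs | x != 0]].

Definition rat_points (f : {mpoly F[m.+1]}) : {set {set vecs}} :=
  [set P in proj_points | [forall x in P, f.@[x] == 0]].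

Definition hypersurface (d : nat) (f : {mpoly F[m.+1]}) : Prop :=
  f != 0 /\ f \is d.-homog.

Definition union_of_Fq_hyperplanes (f : {mpoly F[m.+1]}) : Prop :=
  exists (c : F) (s : seq {mpoly F[m.+1]}),
    c != 0 /\ all (fun l => (l != 0) && (l \is 1.-homog)) s /\
    f = c *: \prod_(l <- s) l.

End Proj.

(* Main.v *)
Require Import Defs.
From HB Require Import structures.
From mathcomp Require Import all_boot all_algebra all_field.
From mathcomp Require Import mxabelem zify ring.
From mathcomp Require Import mpoly.
Set Implicit Arguments. Unset Strict Implicit. Unset Printing Implicit Defensive.
Import GRing.Theory.
Local Open Scope ring_scope.

(* Count zeros in the affine cone: N rational points give 1 + (q - 1) N zeros.
   Write d = n + 1, and let Z be the zero set of the form f.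

   If d distinct hyperplanes lie in Z, then f is a product of linear forms. If
   these do not all contain a common codimension-2 space, count the zeros off
   the first hyperplane H1 along lines in a direction P that lies on H1 and H2
   but not on some H3. If fewer than d hyperplanes lie in Z and they cover Z,
   a union bound suffices.

   Otherwise some zero lies on no hyperplane contained in Z. Take a linear
   space U through it, maximal among those contained in Z; it has codimension
   at least 2. On each coset U + v the function f is nonzero of degree at most
   n, with leading form u |-> Df(u)(v), linear in v. Schwartz-Zippel on each
   coset is enough when 2n <= q. When 2n > q, a coset whose count comes close to
   the Schwartz-Zippel bound has a leading form that is invariant under
   translation by each of its zeros (otherwise counting along lines in the
   direction of such a zero gains). If all members of a pencil of leading forms
   had this property, three of them would be y^n, x^n and (x - y)^n up to
   scalars, so x |-> x^n would be additive on F; then n is a power of the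
   characteristic and 2n <= q. Hence every pencil contains a defective coset,
   which gives the gain in the bound. *)

(** * Polynomial functions on coordinate spaces *)

Section PolynomialFunctions.
Variable F : finFieldType.
Local Notation q := #|F|.

(* With [strict], homogeneous of degree n; otherwise, of degree at most n. Since
   the degree is that of an expression and not of the function, the zero
   function has every degree. *)
Inductive polyfun (strict : bool) (k : nat) : nat -> ('rV[F]_k -> F) -> Prop :=
| polyfun0 n : polyfun strict n (fun _ => 0)
| polyfunC c : polyfun strict 0 (fun _ => c)
| polyfunL (a : 'cV_k) : polyfun strict 1 (fun x => (x *m a) 0 0)
| polyfunD n g h : polyfun strict n g -> polyfun strict n h ->
    polyfun strict n (fun x => g x + h x)
| polyfunM n m g h : polyfun strict n g -> polyfun strict m h ->
    polyfun strict (n + m) (fun x => g x * h x)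
| polyfunW n m g : ~~ strict -> (n <= m)%N ->
    polyfun strict n g -> polyfun strict m g
| polyfun_ext n g h : g =1 h -> polyfun strict n g -> polyfun strict n h.

Local Notation homfun := (polyfun true).
Local Notation degfun := (polyfun false).

Lemma degfunW k n m (g : 'rV_k -> F) :
  (n <= m)%N -> degfun n g -> degfun m g.
Proof. exact: polyfunW. Qed.

Lemma homfun_degfun k n (g : 'rV_k -> F) : homfun n g -> degfun n g.
Proof.
elim=> {n g} [n|c|a|n g h _ Hg _ Hh|n m g h _ Hg _ Hh|//|n g h gh _ Hg].
- exact: polyfun0.
- exact: polyfunC.
- exact: polyfunL.
- exact: polyfunD.
- exact: polyfunM.
- exact: polyfun_ext gh Hg.
Qed.

Lemma polyfun_sum s k n (I : Type) (r : seq I) (P : pred I) (h : I -> 'rV_k -> F) :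
  (forall i, P i -> polyfun s n (h i)) ->
  polyfun s n (fun x => \sum_(i <- r | P i) h i x).
Proof.
move=> Hh; elim: r => [|i r IHr].
  by apply: polyfun_ext (polyfun0 s k n) => x; rewrite big_nil.
case Pi: (P i); last by apply: polyfun_ext IHr => x; rewrite big_cons Pi.
by apply: polyfun_ext (polyfunD (Hh i Pi) IHr) => x; rewrite big_cons Pi.
Qed.

Lemma polyfun_prod s k (I : Type) (r : seq I) (d : I -> nat) (h : I -> 'rV_k -> F) :
  (forall i, polyfun s (d i) (h i)) ->
  polyfun s (\sum_(i <- r) d i) (fun x => \prod_(i <- r) h i x).
Proof.
move=> Hh; elim: r => [|i r IHr].
  by rewrite big_nil; apply: polyfun_ext (polyfunC s k 1) => x; rewrite big_nil.
by rewrite big_cons; apply: polyfun_ext (polyfunM (Hh i) IHr) => x; rewrite big_cons.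
Qed.

Lemma polyfun_exp s k n m (g : 'rV_k -> F) :
  polyfun s n g -> polyfun s (n * m) (fun x => g x ^+ m).
Proof.
move=> Hg; elim: m => [|m IHm].
  by rewrite muln0; apply: polyfun_ext (polyfunC s k 1) => x; rewrite expr0.
by rewrite mulnS; apply: polyfun_ext (polyfunM Hg IHm) => x; rewrite exprS.
Qed.

Lemma polyfunZ s k n c (g : 'rV_k -> F) :
  polyfun s n g -> polyfun s n (fun x => c * g x).
Proof. by move=> Hg; apply: (polyfunM (polyfunC s k c) Hg). Qed.

Lemma polyfun_mulmx s k l n (g : 'rV_k -> F) (B : 'M_(l, k)) :
  polyfun s n g -> polyfun s n (fun y => g (y *m B)).
Proof.
elim=> {n g} [n|c|a|n g h _ Hg _ Hh|n m g h _ Hg _ Hh|n m g ns le_nm _ Hg|n g h gh _ Hg].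
- exact: polyfun0.
- exact: polyfunC.
- by apply: polyfun_ext (polyfunL s (B *m a)) => y; rewrite mulmxA.
- exact: polyfunD.
- exact: polyfunM.
- exact: polyfunW Hg.
- by apply: polyfun_ext Hg => y; apply: gh.
Qed.

Lemma homfunZ k n (g : 'rV_k -> F) t x :
  homfun n g -> g (t *: x) = t ^+ n * g x.
Proof.
elim=> {n g} [n|c|a|n g h _ Hg _ Hh|n m g h _ Hg _ Hh|//|n g h gh _ Hg].
- by rewrite mulr0.
- by rewrite expr0 mul1r.
- by rewrite -scalemxAl mxE expr1.
- by rewrite Hg Hh mulrDr.
- by rewrite Hg Hh exprD mulrACA.
- by rewrite -!gh.
Qed.

(** By induction on the expression of [h]. The coefficients are built formally, so the degree bounds
    hold even when the values of [h] on a line do not determine the polynomial [C u v]. The last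
    clause makes the coefficient of t usable as a directional derivative, linear in the
    direction. *)
Lemma polyfun_expand s k n (h : 'rV_k -> F) : polyfun s n h ->
  exists C : 'rV_k -> 'rV_k -> {poly F},
  [/\ forall u v t, (C u v).[t] = h (u + t *: v),
      forall i v, (i <= n)%N -> polyfun s (n - i) (fun u => (C u v)`_i),
      forall u v, (size (C u v) <= n.+1)%N
    & forall u a v w, (C u (a *: v + w))`_1 = a * (C u v)`_1 + (C u w)`_1].
Proof.
elim=> {n h} [n|c|a|n g h _ [C1 [E1 P1 S1 L1]] _ [C2 [E2 P2 S2 L2]]
  |n m g h Pg [C1 [E1 P1 S1 L1]] Ph [C2 [E2 P2 S2 L2]]
  |n m g ns le_nm _ [C [E P S L]]|n g h gh _ [C [E P S L]]].
- exists (fun _ _ => 0); split=> [u v t|i v _|u v|u a v w].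
  + by rewrite horner0.
  + by apply: polyfun_ext (polyfun0 s k _) => u; rewrite coef0.
  + by rewrite size_poly0.
  + by rewrite coef0 mulr0 addr0.
- exists (fun _ _ => c%:P); split=> [u v t|i v|u v|u a v w].
  + by rewrite hornerC.
  + by rewrite leqn0 => /eqP->; apply: polyfun_ext (polyfunC s k c) => u; rewrite coefC.
  + exact: size_polyC_leq1.
  + by rewrite coefC /= mulr0 addr0.
- exists (fun u v => ((u *m a) 0 0)%:P + ((v *m a) 0 0) *: 'X).
  split=> [u v t|[|[|//]] v _|u v|u b v w].
  + by rewrite !hornerE mulmxDl -scalemxAl !mxE mulrC.
  + by apply: polyfun_ext (polyfunL s a) => u; rewrite coefD coefC coefZ coefX /= mulr0 addr0.
  + apply: polyfun_ext (polyfunC s k ((v *m a) 0 0)) => u.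
    by rewrite coefD coefC coefZ coefX /= mulr1 add0r.
  + rewrite (leq_trans (size_polyD _ _)) // geq_max (leq_trans (size_polyC_leq1 _)) //.
    by rewrite (leq_trans (size_scale_leq _ _)) // size_polyX.
  + by rewrite !coefD !coefC !coefZ !coefX /= !add0r !mulr1 mulmxDl -scalemxAl !mxE.
- exists (fun u v => C1 u v + C2 u v); split=> [u v t|i v le_in|u v|u a v w].
  + by rewrite hornerD E1 E2.
  + by apply: polyfun_ext (polyfunD (P1 i v le_in) (P2 i v le_in)) => u; rewrite coefD.
  + by rewrite (leq_trans (size_polyD _ _)) // geq_max S1 S2.
  + by rewrite !coefD L1 L2 mulrDr addrACA.
- have C10 u v : (C1 u v)`_0 = g u by rewrite -horner_coef0 E1 scale0r addr0.
  have C20 u v : (C2 u v)`_0 = h u by rewrite -horner_coef0 E2 scale0r addr0.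
  exists (fun u v => C1 u v * C2 u v); split=> [u v t|i v le_in|u v|u a v w].
  + by rewrite hornerM E1 E2.
  + apply: (@polyfun_ext _ _ _ (fun u => \sum_(j < i.+1) (C1 u v)`_j * (C2 u v)`_(i - j))).
      by move=> u; rewrite coefM.
    apply: polyfun_sum => j _.
    (* Outside j <= n and i - j <= m the natural subtractions in the degrees truncate; there the
       product is zero because one coefficient lies beyond the size. *)
    have [le_jn|lt_nj] := leqP j n; last first.
      apply: polyfun_ext (polyfun0 s k _) => u.
      by rewrite (nth_default _ (leq_trans (S1 u v) lt_nj)) mul0r.
    have [le_jm|lt_mj] := leqP (i - j) m; last first.
      apply: polyfun_ext (polyfun0 s k _) => u.
      by rewrite [X in _ * X](nth_default _ (leq_trans (S2 u v) lt_mj)) mulr0.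
    have -> : (n + m - i = (n - j) + (m - (i - j)))%N.
      by have := ltn_ord j; lia.
    exact: polyfunM (P1 j v le_jn) (P2 (i - j)%N v le_jm).
  + by rewrite (leq_trans (size_polyMleq _ _)) //; have := S1 u v; have := S2 u v; lia.
  + have coef1M (p r : {poly F}) : (p * r)`_1 = p`_0 * r`_1 + p`_1 * r`_0.
      by rewrite coefM !big_ord_recl big_ord0 addr0.
    by rewrite !coef1M !C10 !C20 L1 L2; ring.
- exists C; split=> // [i v le_im|u v].
    have [le_in|lt_ni] := leqP i n; first by apply: polyfunW (P i v le_in); rewrite // leq_sub2r.
    apply: polyfun_ext (polyfun0 s k _) => u.
    by rewrite nth_default // (leq_trans (S u v)).
  by rewrite (leq_trans (S u v)).
- by exists C; split=> // u v t; rewrite -gh.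
Qed.

Lemma polyfun_expand0 k (C : 'rV_k -> 'rV_k -> {poly F}) h :
  (forall u v t, (C u v).[t] = h (u + t *: v)) -> forall u v, (C u v)`_0 = h u.
Proof. by move=> E u v; rewrite -horner_coef0 E scale0r addr0. Qed.

Definition zeros k (h : 'rV[F]_k -> F) := #|[set x | h x == 0]|.

Lemma card_rV k : #|{: 'rV[F]_k}| = (q ^ k)%N.
Proof. by rewrite card_mx mul1n. Qed.

Lemma zerosE k (h : 'rV_k -> F) : zeros h = (\sum_x (h x == 0%R))%N.
Proof. by rewrite /zeros -sum1dep_card big_mkcond; apply: eq_bigr => x _; case: (_ == _). Qed.

Lemma card_roots_le (p : {poly F}) : p != 0 -> (#|[set t | p.[t] == 0%R]| <= (size p).-1)%N.
Proof.
move=> p_neq0; rewrite cardE -ltnS prednK ?lt0n ?size_poly_eq0 //.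
apply: max_poly_roots => //; last by rewrite enum_uniq.
by apply/allP => t; rewrite mem_enum inE.
Qed.

Lemma poly_eq0_roots (p : {poly F}) (A : {set F}) :
  (size p <= #|A|)%N -> {in A, forall t, p.[t] = 0} -> p = 0.
Proof.
move=> le_pA pA; apply/eqP; apply/negPn/negP => p_neq0.
have := card_roots_le p_neq0; apply/negP; rewrite -ltnNge.
rewrite prednK ?lt0n ?size_poly_eq0 // (leq_trans le_pA) //.
by apply/subset_leq_card/subsetP => t /pA ptn; rewrite inE ptn.
Qed.

(** Double counting of the pairs (y, t): for fixed t, translation by [t *: P] permutes the space. *)
Lemma sum_zeros_lines k (h : 'rV_k -> F) (P : 'rV_k) :
  (q * zeros h = \sum_y #|[set t : F | h (y + t *: P)%R == 0%R]|)%N.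
Proof.
under eq_bigr => y _ do rewrite -sum1dep_card big_mkcond.
rewrite exchange_big /= (eq_bigr (fun _ => zeros h)); last first.
  move=> t _; rewrite zerosE [RHS](reindex_inj (addIr (t *: P))) /=.
  by apply: eq_bigr => y _; case: (_ == _).
by rewrite sum_nat_const.
Qed.

(** A line on which the coefficient of t^b is nonzero carries at most b zeros, any other line at
    most q. The last hypothesis, Schwartz-Zippel for a coefficient of degree n - b, bounds the
    number of lines of the second sort. *)
Lemma line_zeros_le k n b (h : 'rV_k -> F) (P : 'rV_k) (C : 'rV_k -> {poly F}) :
  (forall y t, (C y).[t] = h (y + t *: P)) ->
  (forall y, size (C y) <= b.+1)%N -> (b <= n)%N -> (b <= q)%N ->
  (q * zeros (fun y => (C y)`_b)%R <= (n - b) * q ^ k)%N ->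
  (q ^ 2 * zeros h <= q ^ k * (b * q + (q - b) * (n - b)))%N.
Proof.
move=> E S le_bn le_bq Hb.
have Hsum : (q * zeros h <= \sum_(y : 'rV[F]_k) (b + (q - b) * ((C y)`_b == 0)%R))%N.
  rewrite (sum_zeros_lines h P); apply: leq_sum => y _.
  have -> : #|[set t | h (y + t *: P) == 0]| = #|[set t | (C y).[t] == 0]|.
    by apply: eq_card => t; rewrite !inE E.
  case: eqP => [_|/eqP Cb]; first by rewrite muln1 subnKC // max_card.
  have C_neq0 : C y != 0 by apply: contraNneq Cb => ->; rewrite coef0.
  by rewrite muln0 addn0 (leq_trans (card_roots_le C_neq0)) //; have := S y; lia.
move: Hsum; rewrite big_split /= sum_nat_const -big_distrr /= -zerosE card_rV.
move: Hb; set z := zeros _; set w := zeros _; set Q := (q ^ k)%N => Hb Hsum.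
have := leq_mul (leqnn (q - b)) Hb; have := leq_mul (leqnn q) Hsum.
rewrite expnS expn1; move: (q - b)%N (n - b)%N => c e.
clear; move: #|F| w z Q => r w z Q; nia.
Qed.
End PolynomialFunctions.

Local Notation homfun := (polyfun true).
Local Notation degfun := (polyfun false).

(** * Schwartz-Zippel, and the gain when the degree drops along a direction *)

Section ZeroCounts.
Variable F : finFieldType.
Local Notation q := #|F|.

(** b is the largest degree in t reached on any of the parallel lines, so that one coefficient
    function serves as leading coefficient on all of them. *)
Lemma exists_top_coef k n i (C : 'rV[F]_k -> {poly F}) (y : 'rV_k) :
  (forall y, size (C y) <= n)%N -> (C y)`_i != 0 ->
  exists b, [/\ (i <= b)%N, (b < n)%N, exists y, (C y)`_b != 0
              & forall y, (size (C y) <= b.+1)%N].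
Proof.
move=> S Ci.
pose Q j := [exists y, (C y)`_j != 0].
have exQ : exists j, Q j by exists i; apply/existsP; exists y.
have Qn j : Q j -> (j <= n)%N.
  case/existsP=> z; apply: contraNT; rewrite -ltnNge => /ltnW lt_nj.
  by rewrite nth_default // (leq_trans (S z)).
case: (ex_maxnP exQ Qn) => b /existsP[z Cb] maxb.
have size_Cb x : (size (C x) <= b.+1)%N.
  apply/leq_sizeP => j lt_bj; apply/eqP; apply: contraTT lt_bj => Cj.
  by rewrite -leqNgt maxb //; apply/existsP; exists x.
exists b; split=> //; last by exists z.
  by apply: maxb; apply/existsP; exists y.
rewrite ltnNge; apply: contra Cb => le_nb.
by rewrite nth_default // (leq_trans (S z)).
Qed.

Lemma exists_pos_coef (p : {poly F}) : p.[1] != p.[0] -> exists2 i, (0 < i)%N & p`_i != 0.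
Proof.
move=> p10; have p_gt1 : (size p > 1)%N.
  by rewrite ltnNge; apply: contra p10 => /size1_polyC ->; rewrite !hornerC.
exists (size p).-1; first by rewrite -subn1 subn_gt0.
by rewrite -lead_coefE lead_coef_eq0 -size_poly_eq0 -lt0n ltnW.
Qed.

Lemma zeros_le k (h : 'rV[F]_k -> F) : (zeros h <= q ^ k)%N.
Proof. by rewrite -card_rV max_card. Qed.

(** Induction on the degree. Two points with different values give a direction in which the degree b
    is positive; the coefficient of t^b has degree n - b and is not identically zero. The bound then
    follows from b q + (q - b)(n - b) = n q - b (n - b). *)
Lemma schwartz_zippel k n (h : 'rV[F]_k -> F) : degfun n h ->
  (exists x, h x != 0) -> (q * zeros h <= n * q ^ k)%N.
Proof.
elim/ltn_ind: n h => n IHn h Hh [x0 hx0].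
have [le_qn|lt_nq] := leqP q n; first exact: leq_mul le_qn (zeros_le h).
case: (boolP [forall x, h x == h x0]) => [/forallP hC|/forallPn[x hx]].
  have -> : zeros h = 0%N; last by rewrite muln0.
  by apply: eq_card0 => x; rewrite !inE (eqP (hC x)) (negPf hx0).
have [C [E P S _]] := polyfun_expand Hh.
pose D y := C y (x - x0).
have [i i_gt0 Di] : exists2 i, (0 < i)%N & (D x0)`_i != 0.
  by apply: exists_pos_coef; rewrite !E scale1r subrKC scale0r addr0.
have [b [le_ib lt_bn [y Db] Sb]] := exists_top_coef (fun y => S y (x - x0)) Di.
have b_gt0 := leq_trans i_gt0 le_ib.
have le_bn : (b <= n)%N by [].
have IHb : (q * zeros (fun y => (D y)`_b)%R <= (n - b) * q ^ k)%N.
  by apply: IHn; [rewrite ltn_subrL b_gt0; lia | exact: P | exists y].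
have := line_zeros_le (E^~ (x - x0)) Sb le_bn (ltnW (leq_ltn_trans le_bn lt_nq)) IHb.
rewrite -(@leq_pmul2l q ((q * zeros h)%N)) ?(leq_trans _ lt_nq) // mulnA mulnn.
move/leq_trans; apply.
rewrite mulnA [(q * n)%N]mulnC [X in (_ <= X)%N]mulnC leq_mul2l.
by apply/orP; right; move: le_bn (ltnW lt_nq); clear; move: #|F| => r; nia.
Qed.

(** If the degree b of [h] in the direction [P] satisfies 0 < b < n, the term b (n - b) lost in the
    proof of Schwartz-Zippel is at least n - 1. *)
Lemma line_defect k n i (h : 'rV[F]_k -> F) (P y : 'rV_k) (C : 'rV_k -> {poly F}) :
  (forall y t, (C y).[t] = h (y + t *: P)) ->
  (forall i, (i < n)%N -> degfun (n - i) (fun y => (C y)`_i)) ->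
  (forall y, size (C y) <= n)%N -> (0 < i)%N -> (C y)`_i != 0 -> (n <= q)%N ->
  (q ^ 2 * zeros h <= q ^ k * (n * q - n.-1))%N.
Proof.
move=> E D S i_gt0 Ci le_nq.
have [b [le_ib lt_bn exb Sb]] := exists_top_coef S Ci.
have SZ := schwartz_zippel (D b lt_bn) exb.
have le_bq := leq_trans (ltnW lt_bn) le_nq.
apply: leq_trans (line_zeros_le E Sb (ltnW lt_bn) le_bq SZ) _.
rewrite leq_mul2l; apply/orP; right.
by move: le_nq lt_bn (leq_trans i_gt0 le_ib); clear; move: #|F| => r; nia.
Qed.

Lemma homfun0_const k (g : 'rV[F]_k -> F) x : homfun 0 g -> g x = g 0.
Proof. by move/(homfunZ 0 x); rewrite scale0r mul1r. Qed.

Lemma homfun_at0 k n (g : 'rV[F]_k -> F) : homfun n.+1 g -> g 0 = 0.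
Proof. by move/(homfunZ 0 0); rewrite scale0r expr0n mul0r. Qed.

(** On the line through 0 and y, [g] is t^(n+1) g(y) and [e] has degree at most n in t. Since n + 1
    < q, equal values force equal polynomials; compare the coefficients of t^(n+1). *)
Lemma homfun_degfun_eq0 k n (g e : 'rV[F]_k -> F) :
  homfun n.+1 g -> degfun n e -> g =1 e -> (n.+1 < q)%N -> forall y, g y = 0.
Proof.
move=> Hg He ge lt_nq y.
have [C [E _ S _]] := polyfun_expand He.
have /eqP : (g y)%:P * 'X^(n.+1) - C 0 y = 0.
  apply: (@poly_eq0_roots _ _ [set: F]) => [|t _].
    rewrite cardsT (leq_trans (size_polyD _ _)) // geq_max size_polyN.
    rewrite (leq_trans (S 0 y) (ltnW _)) // andbT mul_polyC.
    by rewrite (leq_trans (size_scale_leq _ _)) // size_polyXn.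
  by rewrite !hornerE E add0r -ge (homfunZ t y Hg) mulrC subrr.
rewrite subr_eq0 => /eqP/(congr1 (fun p : {poly F} => p`_n.+1)).
by rewrite coefCM coefXn eqxx mulr1 (nth_default _ (S 0 y)).
Qed.

(** The coefficient of t^n is homogeneous of degree 0 in u, hence constant. At u = 0 the lower
    coefficients vanish, being forms of positive degree, and t = 1 gives the value. *)
Lemma homfun_top_coef k n (g : 'rV[F]_k -> F) (C : 'rV_k -> 'rV_k -> {poly F}) :
  homfun n g -> (forall u v t, (C u v).[t] = g (u + t *: v)) ->
  (forall i v, (i <= n)%N -> homfun (n - i) (fun u => (C u v)`_i)) ->
  (forall u v, size (C u v) <= n.+1)%N -> forall u v, (C u v)`_n = g v.
Proof.
move=> Hg E P S u v.
have Hn : homfun 0 (fun u => (C u v)`_n) by have := P n v (leqnn n); rewrite subnn.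
rewrite (homfun0_const u Hn).
have := E 0 v 1; rewrite scale1r add0r => <-.
rewrite (horner_coef_wide _ (S 0 v)) big_ord_recr /= expr1n mulr1 big1 ?add0r //.
move=> [i /= lt_in] _; have := P i v (ltnW lt_in).
by rewrite -[(n - i)%N]prednK ?subn_gt0 // => /homfun_at0 ->; rewrite mul0r.
Qed.

(** For a form of positive degree this means that the zeros are a linear subspace and that the form
    descends to the quotient, where it vanishes only at 0. *)
Definition conical k (g : 'rV[F]_k -> F) : Prop :=
  (exists y, g y != 0) /\ (forall P y, g P = 0 -> g (y + P) = g y).

(** If the leading form [g] were zero, [h] would have degree n - 1 and too few zeros. If [g P = 0]
    but translation by [P] changes [g], then in direction [P] the degree of [h] is positive and
    below n, and [line_defect] applies. *)
Lemma homfun_cone k n (h g e : 'rV[F]_k -> F) :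
  (0 < n)%N -> (n < q)%N -> homfun n g -> degfun n.-1 e ->
  (forall y, h y = g y + e y) -> (exists y, h y != 0) ->
  (q ^ k * (n * q - n.-1) < q ^ 2 * zeros h)%N ->
  conical g.
Proof.
move=> n_gt0 lt_nq Hg He hE h_neq0 nbad; split.
  apply/existsP; apply: contraTT nbad; rewrite -leqNgt => /existsPn g0.
  have /schwartz_zippel/(_ h_neq0) : degfun n.-1 h.
    by apply: polyfun_ext He => y; rewrite hE (eqP (negPn (g0 y))) add0r.
  move: lt_nq n_gt0; rewrite expnS expn1; clear.
  by move: #|F| (zeros h) (#|F| ^ k)%N => r z Q; nia.
move=> P y gP0; apply/eqP; apply: contraTT nbad; rewrite -leqNgt => gyP.
have [Cg [Eg Dg Sg _]] := polyfun_expand Hg.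
have [Ce [Ee De Se _]] := polyfun_expand He.
have Cgn := homfun_top_coef Hg Eg Dg Sg.
have Sgn u : (size (Cg u P) <= n)%N.
  apply/leq_sizeP => j; rewrite leq_eqVlt => /predU1P[<-|lt_nj]; first by rewrite Cgn.
  by rewrite nth_default // (leq_trans (Sg u P)).
have [i i_gt0 Cgi] : exists2 i, (0 < i)%N & (Cg y P)`_i != 0.
  by apply: exists_pos_coef; rewrite !Eg scale1r scale0r addr0.
have lt_in : (i < n)%N.
  by rewrite ltnNge; apply: contra Cgi => le_ni; rewrite nth_default // (leq_trans (Sgn y)).
(* The lower part cannot cancel the coefficient of [g] everywhere: one is a form of degree n - i,
   the other has degree at most n - 1 - i. *)
have /existsP[z Cz] : [exists z, (Cg z P + Ce z P)`_i != 0].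
  apply: contraNT Cgi => /existsPn C0; apply/eqP.
  have Hi : homfun (n.-1 - i).+1 (fun u => (Cg u P)`_i).
    by have -> : (n.-1 - i).+1 = (n - i)%N by [lia]; apply: Dg; apply: ltnW.
  have Hj : degfun (n.-1 - i) (fun u => - 1 * (Ce u P)`_i).
    by apply: polyfunZ; apply: De; lia.
  apply: (homfun_degfun_eq0 Hi Hj) => [u|]; last by lia.
  by have := negPn (C0 u); rewrite coefD addr_eq0 mulN1r => /eqP.
apply: (@line_defect k n i h P z (fun u => Cg u P + Ce u P)) => // [u t|j lt_jn|u|].
- by rewrite hornerD Eg Ee hE.
- apply: (@polyfun_ext _ _ _ _ (fun u => (Cg u P)`_j + (Ce u P)`_j)) => [u|].
    by rewrite coefD.
  apply: polyfunD; first by apply: homfun_degfun; apply: Dg; apply: ltnW.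
  by apply: degfunW (De j P _); lia.
- by rewrite (leq_trans (size_polyD _ _)) // geq_max Sgn (leq_trans (Se u P)) // prednK.
- exact: ltnW.
Qed.
End ZeroCounts.

(** * Linear subspaces contained in the zero set *)

Section Pencils.
Variable F : finFieldType.
Local Notation q := #|F|.

(** Since n < q, (X - 1)^n = X^n - 1 holds for polynomials. For n >= 2 the derivatives at 1 are 0
    and n, so the characteristic p divides n; injectivity of Frobenius passes the hypothesis to n /
    p. Thus n is a power of p below q, itself a power of p, and p n <= q. *)
Lemma additive_exp_le n : (0 < n)%N -> (n < q)%N ->
  (forall x y : F, (x - y) ^+ n = x ^+ n - y ^+ n) -> (2 * n <= q)%N.
Proof.
move=> n_gt0 lt_nq addn.
have [p pr_p pcharFp] := finPcharP F.
have [s nE] : exists s, n = (p ^ s)%N.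
  elim/ltn_ind: n n_gt0 lt_nq addn => -[//|[|n]] IHn _ lt_nq addn; first by exists 0%N.
  have /dvdnP[j nE] : (p %| n.+2)%N.
    rewrite (dvdn_pcharf pcharFp).
    have /eqP : ('X - 1%:P) ^+ n.+2 - ('X ^+ n.+2 - 1%:P) = 0 :> {poly F}.
      apply: (@poly_eq0_roots _ _ [set: F]) => [|t _]; last first.
        by rewrite !hornerE addn expr1n subrr.
      rewrite cardsT (leq_trans _ lt_nq) // (leq_trans (size_polyD _ _)) // geq_max.
      by rewrite size_exp_XsubC ltnSn size_polyN size_XnsubC ?leqnn.
    rewrite subr_eq0 => /eqP/(congr1 (fun r : {poly F} => r^`().[1])).
    rewrite deriv_exp [('X ^+ _ - _)^`()]derivB derivXn derivXsubC derivC subr0.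
    rewrite !hornerMn hornerM hornerC horner_exp hornerXsubC hornerXn subrr expr0n expr1n.
    by rewrite mulr0 mul0rn => <-.
  have p_gt0 := prime_gt0 pr_p.
  have [s jE] : exists s, j = (p ^ s)%N.
    apply: IHn; first by rewrite nE ltn_Pmulr ?prime_gt1 //; case: j nE.
    - by case: j nE.
    - by rewrite (leq_ltn_trans _ lt_nq) // nE leq_pmulr.
    - move=> x y; apply: (fmorph_inj (pFrobenius_aut pcharFp)).
      by rewrite rmorphB /= !pFrobenius_autE -!exprM -nE addn.
  by exists s.+1; rewrite nE jE expnSr.
have qE := card_pprimeChar pcharFp.
move: lt_nq; rewrite nE qE ltn_exp2l ?prime_gt1 // => lt_s.
rewrite (@leq_trans (p * p ^ s)%N) ?leq_mul2r ?prime_gt1 ?orbT //.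
by rewrite -expnS leq_exp2l ?prime_gt1.
Qed.

(** Take a basis [g1], [g2] of the pencil and points [P], [Q] with [g1 P = 0] and [g2 Q = 0], the
    other two values being nonzero. Invariance makes the two members multiples of y^n and x^n at x P
    + y Q. A third member, vanishing at P + Q, links them. *)
Lemma conical_pencil k n (A B : 'rV[F]_k -> F) : homfun n A -> homfun n B ->
  (forall a b, (a != 0) || (b != 0) -> conical (fun y => a * A y + b * B y)) ->
  forall x y : F, (x - y) ^+ n = x ^+ n - y ^+ n.
Proof.
move=> HA HB HAB.
have [Q AQ] : exists Q, A Q != 0.
  by have [|[Q]] := HAB 1 0; rewrite ?oner_eq0 // mul1r mul0r addr0; exists Q.
pose c := B Q / A Q; pose g2 := fun y => B y - c * A y.
have g2Q : g2 Q = 0 by rewrite /g2 /c divfK ?subrr.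
have K a b : (a != 0) || (b != 0) -> conical (fun y => a * A y + b * g2 y).
  move=> ab; have [|[y Ky] Kc] := HAB (a - b * c) b.
    by case: (eqVneq b 0) ab => [->|]; rewrite ?orbT // orbF mul0r subr0 => ->.
  have E z : a * A z + b * g2 z = (a - b * c) * A z + b * B z by rewrite /g2; ring.
  by split=> [|P z]; [exists y; rewrite E | rewrite !E; apply: Kc].
have [P g2P] : exists P, g2 P != 0.
  by have [|[P]] := K 0 1; rewrite ?oner_eq0 ?orbT // mul1r mul0r add0r; exists P.
pose e := A P / g2 P; pose g1 := fun y => A y - e * g2 y.
have g1P : g1 P = 0 by rewrite /g1 /e divfK ?subrr.
have g1Q : g1 Q != 0 by rewrite /g1 g2Q mulr0 subr0.
have Hg2 : homfun n g2.
  apply: polyfun_ext (polyfunD HB (polyfunZ (- c) HA)) => y; rewrite /g2; ring.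
have Hg1 : homfun n g1.
  apply: polyfun_ext (polyfunD HA (polyfunZ (- e) Hg2)) => y; rewrite /g1; ring.
have cone a b R z : (a != 0) || (b != 0) -> a * g1 R + b * g2 R = 0 ->
    a * g1 (z + R) + b * g2 (z + R) = a * g1 z + b * g2 z.
  have E w : a * g1 w + b * g2 w = a * A w + (b - a * e) * g2 w by rewrite /g1; ring.
  move=> ab; have [|_ Kc] := K a (b - a * e); last by rewrite !E; apply: Kc.
  by case: (eqVneq a 0) ab => [->|] //=; rewrite mul0r subr0.
have g1PQ x y : g1 (x *: P + y *: Q) = y ^+ n * g1 Q.
  rewrite addrC -(homfunZ y Q Hg1).
  have := cone 1 0 (x *: P) (y *: Q); rewrite !mul1r !mul0r !addr0; apply.
    by rewrite oner_eq0.
  by rewrite (homfunZ x P Hg1) g1P mulr0.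
have g2PQ x y : g2 (x *: P + y *: Q) = x ^+ n * g2 P.
  rewrite -(homfunZ x P Hg2).
  have := cone 0 1 (y *: Q) (x *: P); rewrite !mul1r !mul0r !add0r; apply.
    by rewrite oner_eq0 orbT.
  by rewrite (homfunZ y Q Hg2) g2Q mulr0.
move=> x y.
(* The member [g2 P * g1 - g1 Q * g2] vanishes at y (P + Q), so it has equal values at (x - y) P and
   at x P + y Q. *)
have := cone (g2 P) (- g1 Q) (y *: P + y *: Q) ((x - y) *: P).
have -> : (x - y) *: P + (y *: P + y *: Q) = x *: P + y *: Q.
  by rewrite addrA -scalerDl subrK.
rewrite g2P => /(_ isT); rewrite !g1PQ !g2PQ (homfunZ _ _ Hg1) (homfunZ _ _ Hg2) g1P.
move=> /(_ ltac:(by ring)) E; apply: (mulfI (mulf_neq0 g2P g1Q)).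
have -> : g2 P * g1 Q * (x - y) ^+ n = - (g2 P * ((x - y) ^+ n * 0) + - g1 Q * ((x - y) ^+ n * g2 P)).
  by ring.
by rewrite -E; ring.
Qed.
End Pencils.

(** * Restriction to the cosets of a maximal subspace of the zero set *)

Section Slices.
Variable F : finFieldType.
Local Notation q := #|F|.

Lemma conicalZ k c (g h : 'rV[F]_k -> F) :
  c != 0 -> (forall y, h y = c * g y) -> conical g -> conical h.
Proof.
move=> c_neq0 hE [[y gy] Kg]; split; first by exists y; rewrite hE mulf_neq0.
move=> P z; rewrite !hE => /eqP; rewrite mulf_eq0 (negPf c_neq0) /= => /eqP gP.
by rewrite Kg.
Qed.

(* G u v is the derivative of f at u in the direction v. *)
Lemma homfun_derivative k n (f : 'rV[F]_k -> F) : homfun n.+1 f ->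
  exists G : 'rV_k -> 'rV_k -> F,
  [/\ forall v, homfun n (G^~ v),
      forall u a v w, G u (a *: v + w) = a * G u v + G u w
    & forall v, exists2 e, degfun n.-1 e & forall u, f (u + v) = f u + (G u v + e u)].
Proof.
move=> Hf; have [C [E D S L]] := polyfun_expand Hf.
exists (fun u v => (C u v)`_1); split=> [v|//|v].
  by have := D 1%N v isT; rewrite subn1.
exists (fun u => \sum_(i < n) (C u v)`_(i.+2)) => [|u].
  apply: polyfun_sum => i _; apply: degfunW (homfun_degfun (D i.+2 v _)).
    by lia.
  by rewrite !ltnS.
rewrite -[in LHS](scale1r v) -E (horner_coef_wide _ (S u v)).
rewrite !big_ord_recl /= (polyfun_expand0 E) !expr1n !mulr1; congr (_ + (_ + _)).
by apply: eq_bigr => i _; rewrite expr1n mulr1 /bump.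
Qed.

Section MaximalSubspace.
Variables (M k n : nat) (f : 'rV[F]_M -> F) (B : 'M[F]_(k, M)).
Hypotheses (Hf : homfun n.+1 f) (n_gt0 : (0 < n)%N) (lt_nq : (n < q)%N).
Hypotheses (freeB : row_free B) (f0 : forall y, f (y *m B) = 0).
Hypothesis (maxB : forall v, ~~ (v <= B)%MS -> exists y, f (y *m B + v) != 0).

(** This is [f] on the coset U + v, where U is the row space of [B]. The index v runs over all
    vectors, so each coset is counted q^k times. *)
Let slice v := fun y : 'rV_k => f (y *m B + v).
Let slice_zeros v := zeros (slice v).

Lemma sum_slice_zeros : (\sum_v slice_zeros v = q ^ k * zeros f)%N.
Proof.
under eq_bigr => v _ do rewrite /slice_zeros zerosE.
rewrite exchange_big /= (eq_bigr (fun _ => zeros f)).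
  by rewrite sum_nat_const card_rV.
by move=> y _; rewrite zerosE [RHS](reindex_inj (addrI (y *m B))).
Qed.

Lemma card_submx l (A : 'M[F]_(l, M)) : #|[set v : 'rV_M | (v <= A)%MS]| = (q ^ \rank A)%N.
Proof. by rewrite -card_rowg; apply: eq_card => v; rewrite !inE. Qed.

Lemma card_nsubmx l (A : 'M[F]_(l, M)) :
  #|[set v : 'rV_M | ~~ (v <= A)%MS]| = (q ^ M - q ^ \rank A)%N.
Proof.
have := cardsC [set v : 'rV_M | (v <= A)%MS].
rewrite card_submx card_rV => <-; rewrite addKn.
by apply: eq_card => v; rewrite !inE.
Qed.

(** The term f(u) in the expansion of f(u + v) vanishes for u in U, which lowers the degree from n +
    1 to n. *)
Lemma degfun_slice v : degfun n (slice v).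
Proof.
have [G [HG _ /(_ v)[e He fE]]] := homfun_derivative Hf.
apply: (@polyfun_ext _ _ _ _ (fun y => G (y *m B) v + e (y *m B))).
  by move=> y; rewrite /slice fE f0 add0r.
apply: polyfunD; first exact: homfun_degfun (polyfun_mulmx B (HG v)).
by apply: polyfun_mulmx; apply: degfunW He; apply: leq_pred.
Qed.

(** The bound of [line_defect]: it saves q^k (n - 1) on the Schwartz-Zippel bound n q^(k+1) for q^2
    times the count. *)
Let defective v := (q ^ 2 * slice_zeros v <= q ^ k * (n * q - n.-1))%N.

Lemma conical_slice G v : ~~ (v <= B)%MS -> ~~ defective v ->
  (forall v, homfun n (G^~ v)) ->
  (forall v, exists2 e, degfun n.-1 e & forall u, f (u + v) = f u + (G u v + e u)) ->
  conical (fun y => G (y *m B) v).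
Proof.
move=> vB nbad HG /(_ v)[e He fE].
apply: (@homfun_cone _ _ n (slice v) _ (fun y => e (y *m B))) => //.
- exact: (polyfun_mulmx B (HG v)).
- exact: (polyfun_mulmx B He).
- by move=> y; rewrite /slice fE f0 add0r.
- exact: maxB.
- by rewrite ltnNge.
Qed.

(** If no such a exists, then [v] and all [a *: v + w] are directions outside U with conical leading
    forms. Up to scalars these are all members of the pencil of leading forms at [v] and [w], so
    n-th powers are additive and 2n <= q. *)
Lemma pencil_defective v w : (q < 2 * n)%N -> ~~ (v <= B)%MS -> ~~ defective v ->
  ~~ (w <= col_mx B v)%MS -> exists a, ~~ ((a *: v + w)%R <= B)%MS && defective (a *: v + w).
Proof.
move=> lt_q2n vB nbad_v wBv; apply/existsP; apply: contraLR lt_q2n => /existsPn nbad.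
rewrite -leqNgt.
have wB a : ~~ ((a *: v + w)%R <= B)%MS.
  apply: contra wBv => avwB; rewrite -[w](addKr (a *: v)); apply: addmx_sub.
    by rewrite -scaleNr scalemx_sub // -addsmxE addsmxSr.
  by apply: submx_trans avwB _; rewrite -addsmxE addsmxSl.
have [G [HG LG EG]] := homfun_derivative Hf.
apply: additive_exp_le => //.
apply: (@conical_pencil _ k n (fun y => G (y *m B) v) (fun y => G (y *m B) w)).
- exact: (polyfun_mulmx B (HG v)).
- exact: (polyfun_mulmx B (HG w)).
move=> a b; have [->|b_neq0 _] := eqVneq b 0.
  rewrite orbF => a_neq0; apply: conicalZ a_neq0 _ (conical_slice vB nbad_v HG EG).
  by move=> y; rewrite mul0r addr0.
have nbad_w := nbad (a / b); rewrite wB in nbad_w.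
apply: (conicalZ b_neq0 _ (conical_slice (wB (a / b)) nbad_w HG EG)) => y.
by rewrite LG mulrDr mulrA [b * (a / b)]mulrC divfK.
Qed.

(** Given a nondefective v outside U, every w outside U + <v> is a defective vector minus one of the
    q multiples of v. Hence there are at least (q^M - q^(k+1)) / q defective vectors. *)
Lemma card_defective : (q < 2 * n)%N -> (k < M)%N ->
  (q ^ M.-1 - q ^ k <= #|[set v | ~~ (v <= B)%MS && defective v]|)%N.
Proof.
move=> lt_q2n lt_kM; set D := [set v | _].
have q_gt0 : (0 < q)%N by rewrite (leq_trans _ lt_nq).
have rkB : \rank B = k by apply/eqP.
case: (boolP [forall v, ~~ (v <= B)%MS ==> defective v]) => [/forallP allD|].
  have -> : D = [set v | ~~ (v <= B)%MS].
    by apply/setP => v; rewrite !inE; case: (v <= B)%MS (allD v).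
  by rewrite card_nsubmx rkB leq_sub2r // leq_exp2l ?leq_pred // (leq_trans _ lt_nq).
case/forallPn => v; rewrite negb_imply => /andP[vB nbad_v].
have rkBv : \rank (col_mx B v) = k.+1.
  apply/eqP; rewrite eqn_leq -{1}[k.+1]addn1 rank_leq_row /= ltnNge.
  apply: contra vB => le_rk.
  have : (\rank (B + v)%MS <= \rank B)%N by rewrite addsmxE rkB.
  by rewrite (geq_leqif (mxrank_leqif_sup (addsmxSl B v))) addsmx_sub => /andP[].
have : ([set w | ~~ (w <= col_mx B v)%MS] \subset
    [set p.2 - p.1 *: v | p in setX [set: F] D]).
  apply/subsetP => w; rewrite inE => /(pencil_defective lt_q2n vB nbad_v)[a Da].
  apply/imsetP; exists (a, a *: v + w); last by rewrite /= addrAC subrr add0r.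
  by rewrite !inE.
move/subset_leq_card/leq_trans/(_ (leq_imset_card _ _)).
have qM : (q ^ M = q * q ^ M.-1)%N by rewrite -expnS prednK // (leq_ltn_trans _ lt_kM).
by rewrite cardsX cardsT card_nsubmx rkBv (expnS q k) qM -mulnBr leq_pmul2l.
Qed.

(** The q^k vectors v in U have slices of at most q^k zeros, whence the term q^(2k). The factor c
    clears denominators and e is the saving on a defective slice. *)
Lemma slice_bound c A e :
  (forall v, ~~ (v <= B)%MS -> c * slice_zeros v <= A)%N ->
  (forall v, ~~ (v <= B)%MS -> defective v -> c * slice_zeros v + e <= A)%N ->
  (c * q ^ k * zeros f + #|[set v | ~~ (v <= B)%MS && defective v]| * e
    <= c * q ^ (2 * k) + (q ^ M - q ^ k) * A)%N.
Proof.
move=> leA leAe; have rkB : \rank B = k by apply/eqP.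
have cB : #|[pred v : 'rV_M | (v <= B)%MS]| = (q ^ k)%N.
  by have := card_submx B; rewrite rkB => <-; apply: eq_card => v; rewrite !inE.
have cBn : #|[pred v : 'rV_M | ~~ (v <= B)%MS]| = (q ^ M - q ^ k)%N.
  by have := card_nsubmx B; rewrite rkB => <-; apply: eq_card => v; rewrite !inE.
rewrite -mulnA -sum_slice_zeros (bigID (fun v => (v <= B)%MS)) /= mulnDr -addnA.
apply: leq_add.
  rewrite leq_mul2l; apply/orP; right.
  apply: (@leq_trans (\sum_(v | (v <= B)%MS) q ^ k)%N).
    by apply: leq_sum => v _; apply: zeros_le.
  by rewrite sum_nat_const cB -expnD addnn mul2n.
have -> : (#|[set v | ~~ (v <= B)%MS && defective v]| * e
    = \sum_(v : 'rV_M | ~~ (v <= B)%MS) if defective v then e else 0)%N.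
  rewrite -sum_nat_const -big_mkcondr.
  by apply: eq_bigl => v; rewrite inE.
rewrite -cBn -sum_nat_const big_distrr -big_split /=; apply: leq_sum => v vB.
by case: ifP => [/(leAe v vB)|_]; rewrite ?addn0 ?leA.
Qed.

Lemma slice_zeros_le v : ~~ (v <= B)%MS -> (q * slice_zeros v <= n * q ^ k)%N.
Proof. by move=> vB; apply: schwartz_zippel (degfun_slice v) (maxB vB). Qed.

Lemma zeros_maximal_le : (k <= M)%N -> (q * zeros f + n * q ^ k <= q ^ k.+1 + n * q ^ M)%N.
Proof.
move=> le_kM.
have le_qkM : (q ^ k <= q ^ M)%N by rewrite leq_exp2l // (leq_trans _ lt_nq).
have leA0 v : ~~ (v <= B)%MS -> defective v -> (q * slice_zeros v + 0 <= n * q ^ k)%N.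
  by move=> vB _; rewrite addn0 slice_zeros_le.
have := slice_bound slice_zeros_le leA0.
have : (0 < q ^ k)%N by rewrite expn_gt0 (leq_trans _ lt_nq).
rewrite muln0 addn0 mul2n -addnn expnD expnS; move: le_qkM.
move: (q ^ k)%N (q ^ M)%N (zeros f) => Q R z; clear; move: #|F| => r.
move=> /subnKC <-; rewrite addKn; move: (R - Q)%N => S Q_gt0.
by rewrite -(leq_pmul2l Q_gt0); nia.
Qed.

Lemma zeros_maximal_defect_le : (q < 2 * n)%N -> (k < M)%N ->
  (q ^ 2 * zeros f + n * q ^ k.+1 + (q ^ M.-1 - q ^ k) * n.-1 <= q ^ k.+2 + n * q ^ M.+1)%N.
Proof.
move=> lt_q2n lt_kM; have cD := card_defective lt_q2n lt_kM.
have le_qkM : (q ^ k <= q ^ M)%N by rewrite leq_exp2l ?(ltnW lt_kM) // (leq_trans _ lt_nq).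
have leA v : ~~ (v <= B)%MS -> (q ^ 2 * slice_zeros v <= n * q ^ k.+1)%N.
  by move=> vB; rewrite expnS expn1 -mulnA (expnS q k) mulnCA leq_mul2l slice_zeros_le ?orbT.
have leAe v : ~~ (v <= B)%MS -> defective v ->
    (q ^ 2 * slice_zeros v + q ^ k * n.-1 <= n * q ^ k.+1)%N.
  move=> vB; rewrite /defective => Dv; apply: leq_trans (leq_add Dv (leqnn _)) _.
  rewrite -mulnDr subnK; last by move: lt_nq; clear; move: #|F| => r; nia.
  by rewrite expnS; clear; move: #|F| (#|F| ^ k)%N => r Q; lia.
have := slice_bound leA leAe.
have := leq_mul cD (leqnn (q ^ k * n.-1)%N).
have : (0 < q ^ k)%N by rewrite expn_gt0 (leq_trans _ lt_nq).
rewrite mul2n -addnn expnD !expnS expn0 muln1; move: le_qkM.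
move: #|[set _ | _]| (q ^ M.-1 - q ^ k)%N n.-1 (q ^ k)%N (q ^ M)%N (zeros f).
move=> D E n1 Q R z; clear; move: #|F| => r.
move=> /subnKC <-; rewrite addKn; move: (R - Q)%N => S Q_gt0.
by rewrite -(leq_pmul2l Q_gt0); nia.
Qed.

End MaximalSubspace.
End Slices.

(** * Hyperplanes contained in the zero set *)

Section Factorization.
Variable F : finFieldType.
Local Notation q := #|F|.

Definition lform M (a : 'cV[F]_M) (x : 'rV_M) : F := (x *m a) 0 0.

Lemma lformD M (a : 'cV[F]_M) x y : lform a (x + y) = lform a x + lform a y.
Proof. by rewrite /lform mulmxDl mxE. Qed.

Lemma lformZ M (a : 'cV[F]_M) c x : lform a (c *: x) = c * lform a x.
Proof. by rewrite /lform -scalemxAl mxE. Qed.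

Lemma lform_eq1 M (a : 'cV[F]_M) : a != 0 -> exists e, lform a e = 1.
Proof.
move=> a_neq0; have /existsP[i ai] : [exists i, a i 0 != 0].
  apply: contraNT a_neq0 => /existsPn a0; apply/eqP/matrixP => i j.
  by rewrite ord1 mxE; apply/eqP/negPn/a0.
exists ((a i 0)^-1 *: delta_mx 0 i).
by rewrite lformZ /lform -rowE mxE mulVf.
Qed.

(** Choose [e] with [lform a e = 1]. Then x = p(x) + a(x) e with p(x) on the hyperplane; expanding
    in powers of a(x), the constant term f(p(x)) vanishes and a(x) factors out. *)
Lemma homfun_factor M n (f : 'rV[F]_M -> F) (a : 'cV_M) : homfun n.+1 f -> a != 0 ->
  (forall x, lform a x = 0 -> f x = 0) ->
  exists2 g, homfun n g & forall x, f x = lform a x * g x.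
Proof.
move=> Hf /lform_eq1[e ae] f0; have [C [E D S _]] := polyfun_expand Hf.
pose p x : 'rV_M := x *m (1%:M - a *m e).
have pE x : p x = x - lform a x *: e.
  rewrite /p mulmxBr mulmx1 mulmxA; congr (_ - _).
  by rewrite [x *m a]mx11_scalar mul_scalar_mx.
have ap x : lform a (p x) = 0 by rewrite pE -scaleNr lformD lformZ ae mulr1 subrr.
exists (fun x => \sum_(i < n.+1) (C (p x) e)`_(i.+1) * lform a x ^+ i).
  apply: polyfun_sum => -[i /= le_in] _.
  have -> : n = (n.+1 - i.+1 + 1 * i)%N by rewrite mul1n subSS subnK // -ltnS.
  apply: polyfunM; first exact: (polyfun_mulmx _ (D i.+1 e le_in)).
  by apply: polyfun_exp; apply: polyfunL.
move=> x; have {1}-> : x = p x + lform a x *: e by rewrite pE subrK.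
rewrite -E (horner_coef_wide _ (S _ _)) big_ord_recl /= (polyfun_expand0 E) f0 // mul0r add0r.
by rewrite big_distrr /=; apply: eq_bigr => i _; rewrite /bump /= exprS mulrCA.
Qed.

(** For nonzero forms this says that the two hyperplanes are distinct. The witness w serves as a
    direction inside the second that leaves the first. *)
Definition hyp_diff M (a b : 'cV[F]_M) : bool :=
  [exists w, (lform b w == 0) && (lform a w != 0)].

(** The claim is clear where a is nonzero. If a(x) = 0, then g vanishes at x + t w for the q - 1
    nonzero t, and its coefficient of t^n is g(w) = 0; so g is zero on the whole line, including t =
    0. *)
Lemma homfun_cofactor M n (g : 'rV[F]_M -> F) (a b : 'cV_M) : homfun n g -> (n < q)%N ->
  hyp_diff a b -> (forall x, lform b x = 0 -> lform a x * g x = 0) ->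
  forall x, lform b x = 0 -> g x = 0.
Proof.
move=> Hg lt_nq /existsP[w /andP[/eqP bw aw]] abg x bx.
have g0 y : lform b y = 0 -> lform a y != 0 -> g y = 0.
  by move=> by0 ay; have /eqP := abg y by0; rewrite mulf_eq0 (negPf ay) => /eqP.
have [ax|ax] := eqVneq (lform a x) 0; last exact: g0.
have [C [E D S _]] := polyfun_expand Hg.
rewrite -(polyfun_expand0 E x w); suff -> : C x w = 0 by rewrite coef0.
apply: (@poly_eq0_roots _ _ [set~ 0]) => [|t].
  have := cardsC1 (0 : F); rewrite /= => ->.
  have le_n : (n <= q.-1)%N by rewrite -ltnS prednK // (leq_ltn_trans _ lt_nq).
  apply: leq_trans le_n; apply/leq_sizeP => j; rewrite leq_eqVlt => /predU1P[<-|lt_nj].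
    by rewrite (homfun_top_coef Hg E D S) g0.
  by rewrite nth_default // (leq_trans (S x w)).
rewrite !inE => t_neq0; rewrite E g0 // lformD lformZ ?bw ?bx ?mulr0 ?addr0 //.
by rewrite ax add0r mulf_neq0.
Qed.

Lemma homfun_factor_seq M n (s : seq 'cV[F]_M) (f : 'rV[F]_M -> F) :
  homfun (size s + n) f -> (size s + n <= q)%N ->
  {in s, forall a, a != 0 /\ forall x, lform a x = 0 -> f x = 0} ->
  pairwise (@hyp_diff M) s ->
  exists2 g, homfun n g & forall x, f x = \prod_(a <- s) lform a x * g x.
Proof.
elim: s f => [|a s IHs] f Hf le_q f0 /=.
  by move=> _; exists f => // x; rewrite big_nil mul1r.
case/andP=> /allP diff_a diff_s.
have [a_neq0 f0a] := f0 a (mem_head a s).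
have [g Hg fE] := homfun_factor (n := size s + n) Hf a_neq0 f0a.
have [|b bs||h Hh gE] := IHs g Hg.
- by apply: ltnW.
- have [b_neq0 f0b] := f0 b (@mem_behead _ (a :: s) b bs); split=> //.
  apply: (homfun_cofactor Hg le_q (diff_a b bs)) => x bx.
  by rewrite -fE f0b.
- by [].
by exists h => // x; rewrite big_cons fE gE mulrA.
Qed.

Definition hplane M (a : 'cV[F]_M) := [set x | lform a x == 0].

Lemma lform_kermx M (a : 'cV[F]_M) x : (lform a x == 0) = (x <= kermx a)%MS.
Proof.
rewrite (sameP sub_kermxP eqP) /lform; apply/eqP/eqP => [xa|->]; last by rewrite mxE.
by apply/matrixP => i j; rewrite !ord1 xa mxE.
Qed.

Lemma card_hplane M (a : 'cV[F]_M) : a != 0 -> #|hplane a| = (q ^ M.-1)%N.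
Proof.
move=> a_neq0; have rk1 : \rank a = 1%N.
  by apply/eqP; rewrite eqn_leq rank_leq_col lt0n mxrank_eq0.
have := card_submx (kermx a); rewrite mxrank_ker rk1 subn1 => <-.
by apply: eq_card => x; rewrite !inE lform_kermx.
Qed.

Lemma hplaneI_kermx M (a b : 'cV[F]_M) x :
  (x \in hplane a :&: hplane b) = (x <= kermx (row_mx a b))%MS.
Proof.
rewrite !inE !lform_kermx; apply/andP/sub_kermxP => [[/sub_kermxP xa /sub_kermxP xb]|].
  by rewrite mul_mx_row xa xb row_mx0.
rewrite mul_mx_row -(row_mx0 _ 1 1 1) => /eq_row_mx[xa xb].
by split; apply/sub_kermxP.
Qed.

Lemma card_hplaneI_ge M (a b : 'cV[F]_M) : (q ^ (M - 2) <= #|hplane a :&: hplane b|)%N.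
Proof.
have -> : #|hplane a :&: hplane b| = (q ^ \rank (kermx (row_mx a b)))%N.
  by rewrite -card_submx; apply: eq_card => x; rewrite hplaneI_kermx inE.
rewrite leq_exp2l ?finNzRing_gt1 // mxrank_ker leq_sub2l //.
exact: (rank_leq_col (row_mx a b)).
Qed.

Lemma card_hplaneI M (a b : 'cV[F]_M) :
  a != 0 -> b != 0 -> hyp_diff a b -> #|hplane a :&: hplane b| = (q ^ (M - 2))%N.
Proof.
move=> a_neq0 b_neq0 /existsP[w /andP[bw aw]]; apply/eqP.
rewrite eqn_leq card_hplaneI_ge andbT.
have cE : #|hplane a :&: hplane b| = (q ^ \rank (kermx (row_mx a b)))%N.
  by rewrite -card_submx; apply: eq_card => x; rewrite hplaneI_kermx inE.
rewrite cE leq_exp2l ?finNzRing_gt1 //.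
have : (#|hplane a :&: hplane b| < #|hplane b|)%N.
  apply: proper_card; apply/properP; split; first exact: subsetIr.
  by exists w; rewrite !inE ?bw // (negPf aw).
rewrite cE card_hplane // ltn_exp2l ?finNzRing_gt1 //.
by lia.
Qed.
End Factorization.

(** * Counting points on unions of hyperplanes *)

Section Arrangements.
Variable F : finFieldType.
Local Notation q := #|F|.

Definition hunion M (s : seq 'cV[F]_M) := [set x | has (fun a => lform a x == 0) s].

Lemma hunion_cons M a (s : seq 'cV[F]_M) : hunion (a :: s) = hplane a :|: hunion s.
Proof. by apply/setP => x; rewrite !inE. Qed.

(** Each further hyperplane shares at least q^(M-2) points with the first one. *)
Lemma card_hunion_le M a (s : seq 'cV[F]_M) : {in a :: s, forall b, b != 0} ->
  (#|hunion (a :: s)| <= q ^ M.-1 + size s * (q ^ M.-1 - q ^ (M - 2)))%N.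
Proof.
elim: s => [|b s IHs] s_neq0.
  rewrite mul0n addn0 -(card_hplane (s_neq0 a _)) ?mem_head //.
  by apply: subset_leq_card; apply/subsetP => x; rewrite !inE /= orbF.
have -> : hunion [:: a, b & s] = hunion (a :: s) :|: (hplane b :\: hplane a).
  by apply/setP => x; rewrite !inE /=; case: (lform a x == 0); case: (lform b x == 0); rewrite ?orbT ?orbF.
apply: leq_trans (leq_card_setU _ _) _.
rewrite /= mulSn addnCA addnC leq_add //.
  rewrite cardsD card_hplane ?leq_sub2l ?s_neq0 ?inE ?eqxx ?orbT //.
  by rewrite setIC card_hplaneI_ge.
by apply: IHs => x; rewrite !inE => /orP[/eqP->|xs]; apply: s_neq0; rewrite !inE ?eqxx ?xs ?orbT.
Qed.

(** Two distinct hyperplanes through [T] meet exactly in [T], by cardinality, so each one adds all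
    its points off [T]. *)
Lemma card_hunion_pencil_ge M (T : {set 'rV[F]_M}) (s : seq 'cV[F]_M) :
  {in s, forall a, a != 0 /\ T \subset hplane a} -> pairwise (@hyp_diff F M) s ->
  #|T| = (q ^ (M - 2))%N ->
  (q ^ (M - 2) + size s * (q ^ M.-1 - q ^ (M - 2)) <= #|T :|: hunion s|)%N.
Proof.
move=> + + cT; elim: s => [|a s IHs] sT /=.
  by rewrite mul0n addn0 -cT subset_leq_card ?subsetUl.
case/andP=> /allP diff_a diff_s.
have [a_neq0 Ta] := sT a (mem_head a s).
have {}IHs : (q ^ (M - 2) + size s * (q ^ M.-1 - q ^ (M - 2)) <= #|T :|: hunion s|)%N.
  by apply: IHs => // b bs; apply: sT; rewrite inE bs orbT.
have IT : hplane a :&: (T :|: hunion s) \subset T.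
  apply/subsetP => x; rewrite !inE => /andP[ax] /orP[//|/hasP[b bs bx]].
  have [b_neq0 Tb] := sT b (@mem_behead _ (a :: s) b bs).
  have TI : T = hplane a :&: hplane b.
    apply/eqP; rewrite eqEcard subsetI Ta Tb cT.
    by rewrite (card_hplaneI a_neq0 b_neq0 (diff_a b bs)) leqnn.
  by rewrite TI !inE ax bx.
have := cardsUI (hplane a) (T :|: hunion s).
have := subset_leq_card IT; rewrite cT => le_I.
have := cardsUI (hplane a) (T :|: hunion s).
rewrite card_hplane // hunion_cons setUCA mulSn.
have : (q ^ (M - 2) <= q ^ M.-1)%N by rewrite leq_exp2l ?finNzRing_gt1 //; lia.
move: (size s * _)%N IHs le_I => A.
move: #|hplane a :&: _| #|T :|: (_ :|: _)| #|T :|: _| => x y z.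
move: (#|F| ^ _)%N (#|F| ^ _)%N => u w; clear; lia.
Qed.

Lemma hplane_eq M (a b : 'cV[F]_M) : a != 0 -> b != 0 -> ~~ hyp_diff a b -> hplane a = hplane b.
Proof.
move=> a_neq0 b_neq0 /existsPn ndiff; apply/esym/eqP.
rewrite eqEcard !card_hplane // leqnn andbT; apply/subsetP => w; rewrite !inE => bw.
by have := ndiff w; rewrite bw negbK.
Qed.

(** Greedy choice of distinct hyperplanes inside the zero set, stopped at j of them; if it stops
    earlier, the family is complete. *)
Lemma hplane_family M (f : 'rV[F]_M -> F) j :
  exists s : seq 'cV[F]_M,
  [/\ {in s, forall a, a != 0 /\ forall x, lform a x = 0 -> f x = 0},
      pairwise (@hyp_diff F M) s
    & size s = j \/ (size s < j)%N /\
      forall a x, a != 0 -> (forall x, lform a x = 0 -> f x = 0) -> lform a x = 0 ->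
        x \in hunion s].
Proof.
elim: j => [|j [s [sf diff_s [sj|[lt_sj cov]]]]]; first by exists [::]; split=> //; left.
  pose P a := [&& a != 0, [forall x, (lform a x == 0) ==> (f x == 0)] & all (hyp_diff a) s].
  case: (pickP P) => [a /and3P[a_neq0 /forallP fa diff_a]|noP].
    exists (a :: s); split=> [b||]; last by left; rewrite /= sj.
      rewrite inE => /predU1P[->|/sf//]; split=> // x ax.
      by have := fa x; rewrite ax eqxx /= => /eqP.
    by rewrite /= diff_a.
  exists s; split=> //; right; split; first by rewrite sj.
  move=> a x a_neq0 fa ax; have := noP a; rewrite /P a_neq0 /=.
  have -> /= : [forall x, (lform a x == 0) ==> (f x == 0)].
    by apply/forallP => y; apply/implyP => /eqP/fa->.
  move/negbT/allPn => [b bs ndiff]; have [b_neq0 _] := sf b bs.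
  rewrite inE; apply/hasP; exists b => //.
  have : x \in hplane a by rewrite inE ax.
  by rewrite (hplane_eq a_neq0 b_neq0 ndiff) inE.
by exists s; split=> //; right; split=> //; apply: ltnW.
Qed.

Lemma degfun_affine M k n (g : 'rV[F]_M -> F) (B : 'M_(k, M)) v :
  degfun n g -> degfun n (fun y => g (y *m B + v)).
Proof.
elim=> {n g} [n|c|a|n g h _ Hg _ Hh|n m g h _ Hg _ Hh|n m g ns le_nm _ Hg|n g h gh _ Hg].
- exact: polyfun0.
- exact: polyfunC.
- have H1 := polyfunD (polyfunL false (B *m a)) (degfunW (leq0n 1) (polyfunC false k ((v *m a) 0 0))).
  by apply: polyfun_ext H1 => y; rewrite mulmxA mulmxDl [in RHS]mxE.
- exact: polyfunD.
- exact: polyfunM.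
- exact: polyfunW Hg.
- by apply: polyfun_ext Hg => y; apply: gh.
Qed.

(** On a coset of the hyperplane of [a] the form [a] is constant, which leaves degree n. In
    direction [P] also [b] is constant, so the degree is below n, while [e] makes it positive on
    some line; [line_defect] then bounds every coset. *)
Lemma zeros_arrangement_le M (f : 'rV[F]_M -> F) c a b (s : seq 'cV[F]_M) e P :
  (forall x, f x = c * \prod_(a <- [:: a, b & s]) lform a x) ->
  (exists x, f x != 0) -> a != 0 -> ((size s).+1 <= q)%N -> (0 < M)%N ->
  lform a P = 0 -> lform b P = 0 -> e \in s -> lform e P != 0 ->
  (q ^ 2 * zeros f <= q ^ M.+1 + (q ^ M - q ^ M.-1) * ((size s).+1 * q - size s))%N.
Proof.
move=> fE [x0 fx0] a_neq0 le_sq M_gt0 aP bP es eP.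
set n := (size s).+1; set B := row_base (kermx a).
have ca : \rank (kermx a) = M.-1.
  apply/eqP; rewrite -(@eqn_exp2l q) ?finNzRing_gt1 // -card_submx -(card_hplane a_neq0).
  by apply/eqP; apply: eq_card => x; rewrite !inE lform_kermx.
have inB v : (v <= B)%MS = (lform a v == 0) by rewrite lform_kermx eq_row_base.
have aB y : lform a (y *m B) = 0 by apply/eqP; rewrite -inB submxMl.
have fZ t x : f (t *: x) = t ^+ (size s).+2 * f x.
  rewrite !fE mulrCA; congr (_ * _).
  have -> : (size s).+2 = size [:: a, b & s] by [].
  elim: [:: a, b & s] => [|i r IHr]; first by rewrite !big_nil mulr1.
  by rewrite !big_cons IHr lformZ exprS mulrACA.
have ax0 : lform a x0 != 0.
  by apply: contraNneq fx0 => ax0; rewrite fE big_cons ax0 mul0r mulr0.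
have [PB PE] : exists PB, P = PB *m B by apply/submxP; rewrite inB aP.
have bound (v : 'rV_M) : ~~ (v <= B)%MS ->
    (q ^ 2 * zeros (fun y => f (y *m B + v)%R) <= q ^ M.-1 * (n * q - n.-1))%N.
  rewrite inB => av.
  (* Rescaling [x0] to the level of v under [a] gives a point of the coset where f is nonzero. *)
  have [y0 y0E] : exists y0, (lform a v / lform a x0) *: x0 - v = y0 *m B.
    apply/submxP; rewrite inB -[X in lform a (_ + X)]scaleN1r lformD !lformZ divfK //.
    by rewrite mulN1r subrr.
  have fy0 : f (y0 *m B + v) != 0.
    by rewrite -y0E subrK fZ mulf_neq0 // expf_neq0 // mulf_neq0 ?invr_eq0.
  (* Adding [t *: P] to that point reaches the hyperplane of [e], so f takes different values at r =
     0 and r = 1 on the line. *)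
  pose t := - lform e (y0 *m B + v) / lform e P.
  have Hs : homfun (size s) (fun x => \prod_(a <- s) lform a x).
    by rewrite -sum1_size; apply: polyfun_prod => i; apply: polyfunL.
  have [C [E D S _]] := polyfun_expand Hs.
  (* [K] collects the factors constant along [P]. It has degree 1 in y, through [b], so that the
     coefficient of r^j has total degree n - j. *)
  pose K y := c * lform a v * lform b (y *m B + v).
  have EK y r : (K y *: C (y *m B + v) (t *: P)).[r] = f ((y + r *: (t *: PB)) *m B + v).
    rewrite hornerZ E fE mulmxDl -!scalemxAl -PE addrAC !big_cons.
    by rewrite /K !lformD !lformZ aP bP aB !mulr0 !addr0 add0r !mulrA.
  have [i i_gt0 Ci] : exists2 i, (0 < i)%N & (K y0 *: C (y0 *m B + v) (t *: P))`_i != 0.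
    apply: exists_pos_coef; rewrite !EK scale1r scale0r addr0.
    rewrite (_ : f ((y0 + t *: PB) *m B + v) = 0) 1?eq_sym //.
    rewrite mulmxDl -scalemxAl -PE addrAC fE !big_cons (big_rem e) //=.
    by rewrite [lform e _]lformD lformZ /t divfK // subrr mul0r !mulr0.
  rewrite -ca.
  apply: (@line_defect _ _ n i _ (t *: PB) y0 (fun y => K y *: C (y *m B + v) (t *: P))) => //.
  - move=> j lt_jn.
    apply: (@polyfun_ext _ _ _ _ (fun y => K y * (C (y *m B + v) (t *: P))`_j)).
      by move=> y; rewrite coefZ.
    rewrite /n subSn //; apply: (@polyfunM _ _ _ 1).
      apply: polyfunZ; apply: degfun_affine; exact: polyfunL.
    by apply: (degfun_affine B v (homfun_degfun (D j (t *: P) _))).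
  - by move=> y; rewrite (leq_trans (size_scale_leq _ _)).
have q_gt0 : (0 < q)%N by rewrite (leq_trans _ le_sq).
have bound0 (v : 'rV_M) : ~~ (v <= B)%MS ->
    (q ^ 2 * zeros (fun y => f (y *m B + v)%R) + 0 <= q ^ M.-1 * (n * q - n.-1))%N.
  by move=> vB; rewrite addn0 bound.
have := slice_bound (n := n) (row_base_free _) bound (fun v vB _ => bound0 v vB).
have qM : (q ^ M = q * q ^ M.-1)%N by rewrite -expnS prednK.
rewrite muln0 addn0 ca /n /= mul2n -addnn expnD !expnS expn0 muln1 qM.
have : (0 < q ^ M.-1)%N by rewrite expn_gt0 q_gt0.
move: (_ * q - _)%N (zeros f) (q ^ M.-1)%N => A z Q; clear; move: #|F| => r Q_gt0 H.
by rewrite -(leq_pmul2l Q_gt0); move: (r * Q - Q)%N H => D; nia.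
Qed.
End Arrangements.

(** * Multivariate polynomials and rational points *)

Section RationalPoints.
Variable F : finFieldType.
Local Notation q := #|F|.

Definition mfun M (f : {mpoly F[M]}) (x : 'rV[F]_M) : F := f.@[x 0].

Lemma homfun_mfun M d (f : {mpoly F[M]}) : f \is d.-homog -> homfun d (mfun f).
Proof.
move/dhomogP => f_homog.
apply: (@polyfun_ext _ _ _ _
  (fun x => \sum_(m <- msupp f | m \in msupp f) f@_m * \prod_i x 0 i ^+ m i)).
  by move=> x; rewrite /mfun mevalE -big_seq.
apply: polyfun_sum => m m_f; have <- : mdeg m = d by apply: f_homog.
apply: polyfunZ; rewrite mdegE.
apply: polyfun_prod => i.
have /(polyfun_exp (m i)) : homfun 1 (fun x : 'rV[F]_M => x 0 i); last by rewrite mul1n.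
by apply: polyfun_ext (polyfunL true (delta_mx i 0)) => x; rewrite -colE mxE.
Qed.

Section Vanishing.
Variable n : nat.
Let restr (m : 'X_{1..n.+1}) : 'X_{1..n} := [multinom m (widen_ord (leqnSn n) i) | i < n].

Lemma mcoeff_muni (p : {mpoly F[n.+1]}) j k :
  ((muni p)`_j)@_k = \sum_(m <- msupp p) p@_m * ((restr m == k) && (m ord_max == j))%:R.
Proof.
rewrite muniE coef_sum raddf_sum; apply: eq_bigr => m _ /=.
rewrite coefZ coefXn; case: eqVneq => _; last by rewrite mulr0 mcoeff0 andbF mulr0.
by rewrite mulr1 mcoeffZ mcoeffX andbT.
Qed.

Lemma meval_muni (p : {mpoly F[n.+1]}) (w : 'I_n -> F) t :
  (map_poly (meval w) (muni p)).[t] = p.@[fun i => oapp w t (unlift ord_max i)].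
Proof.
rewrite muniE mevalE raddf_sum horner_sum; apply: eq_bigr => m _ /=.
rewrite map_polyZ map_polyXn hornerZ hornerXn /= mevalZ mevalX big_ord_recr /= unlift_none /= -mulrA.
congr (_ * (_ * _)); apply: eq_bigr => i _; rewrite mnmE.
have -> : widen_ord (leqnSn n) i = lift ord_max i by apply/val_inj; rewrite /= /bump leqNgt ltn_ord.
by rewrite liftK.
Qed.

End Vanishing.

(** Induction on the number of variables, with [p] seen as a polynomial in the last one: after
    specializing the others it has degree below q and q roots. *)
Lemma reduced_mpoly_eq0 n (p : {mpoly F[n]}) :
  {in msupp p, forall m : 'X_{1..n}, forall i, (m i < q)%N} -> (forall v, p.@[v] = 0) -> p = 0.
Proof.
elim: n p => [|n IHn] p red_p p0.
  apply/mpolyP => m; rewrite mcoeff0.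
  have mE (k : 'X_{1..0}) : k = 0%MM by apply/mnmP => -[].
  have pE : p = (p@_0%MM)%:MP.
    by apply/mpolyP => k; rewrite mcoeffC (mE k) eqxx mulr1.
  by have := p0 (fun _ => 0); rewrite {1}pE mevalC (mE m).
have muni0 j : (muni p)`_j = 0.
  apply: IHn => [k|w].
    rewrite mcoeff_msupp mcoeff_muni => nz i; apply: contraNT nz => le_q.
    rewrite big_seq big1 // => m m_p; case: eqP => [mk|]; rewrite ?mulr0 //=.
    by case/negP: le_q; rewrite -mk mnmE red_p.
  have -> : ((muni p)`_j).@[w] = (map_poly (meval w) (muni p))`_j by rewrite coef_map.
  rewrite (_ : map_poly _ _ = 0) ?coef0 //.
  apply: (@poly_eq0_roots _ _ [set: F]) => [|t _]; last by rewrite meval_muni p0.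
  rewrite cardsT (leq_trans (size_poly _ _)) //; apply/leq_sizeP => i le_qi.
  apply/mpolyP => k; rewrite mcoeff0 mcoeff_muni big_seq big1 // => m m_p.
  case: (m ord_max =P i) => [mi|]; rewrite ?andbF ?mulr0 //.
  by have := red_p m m_p ord_max; rewrite mi ltnNge le_qi.
apply/mpolyP => m; rewrite mcoeff0; apply/eqP/negPn/negP => pm.
have m_p : m \in msupp p by rewrite mcoeff_msupp.
have := mcoeff_muni p (m ord_max) [multinom m (widen_ord (leqnSn n) i) | i < n].
rewrite muni0 mcoeff0 (bigD1_seq m) ?msupp_uniq //= !eqxx mulr1 big1 ?addr0 => [pm0|k ne_km].
  by rewrite -pm0 eqxx in pm.
case: andP => [[/eqP/mnmP restr_km /eqP max_km]|]; last by rewrite mulr0.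
case/eqP: ne_km; apply/mnmP => i; case: (unliftP ord_max i) => [j ->|-> //].
have -> : lift ord_max j = widen_ord (leqnSn n) j by apply/val_inj; rewrite /= /bump leqNgt ltn_ord.
by have := restr_km j; rewrite !mnmE.
Qed.

(* The bound is sharp: x ^ q * y - x * y ^ q vanishes at every point. *)
Lemma dhomog_eq0 n d (f : {mpoly F[n]}) : f \is d.-homog -> (d <= q)%N ->
  (forall v, f.@[v] = 0) -> f = 0.
Proof.
move=> /dhomogP f_homog le_dq f0; apply: reduced_mpoly_eq0 => // m m_f i.
rewrite ltnNge; apply/negP => le_qm.
(* An exponent of at least q uses up the whole degree, so such a monomial is a pure power of the
   variable i. *)
have single (k : 'X_{1..n}) : k \in msupp f -> (q <= k i)%N -> forall j, j != i -> k j = 0%N.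
  move=> k_f le_qk j ne_ji; have /= := f_homog k k_f; rewrite mdegE (bigD1 i) //= (bigD1 j) //=.
  by lia.
(* At the i-th unit vector only that pure power survives, and the value is its nonzero
   coefficient. *)
have := f0 (fun j => (j == i)%:R).
rewrite mevalE (bigD1_seq m) ?msupp_uniq //= big1 => [|j _]; last first.
  case: (eqVneq j i) => [_|ne_ji]; first by rewrite expr1n.
  by rewrite (single m m_f le_qm j ne_ji) expr0.
rewrite big_seq_cond big1 ?addr0 ?mulr1 => [/eqP|k /andP[k_f ne_km]].
  by apply/negP; rewrite -mcoeff_msupp.
have /existsP[j /andP[ne_ji kj]] : [exists j, (j != i) && (k j != 0%N)].
  apply: contraNT ne_km => /existsPn k0.
  have {}k0 j : j != i -> k j = 0%N.
    by move=> ne_ji; have := k0 j; rewrite ne_ji negbK => /eqP.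
  have sumE (h : 'X_{1..n}) : (forall j, j != i -> h j = 0%N) -> mdeg h = h i.
    by move=> h0; rewrite mdegE (bigD1 i) //= big1 ?addn0.
  apply/eqP/mnmP => j; case: (eqVneq j i) => [->|ne_ji].
    by rewrite -(sumE k) // -(sumE m (single m m_f le_qm)) !f_homog.
  by rewrite k0 // (single m m_f le_qm).
by rewrite (bigD1 j) //= (negPf ne_ji) expr0n (negPf kj) mul0r mulr0.
Qed.

Definition mlform M (a : 'cV[F]_M) : {mpoly F[M]} := \sum_i a i 0 *: 'X_i.

Lemma meval_mlform M (a : 'cV[F]_M) v : (mlform a).@[v] = lform a (\row_i v i).
Proof.
rewrite /mlform /lform raddf_sum mxE; apply: eq_bigr => i _.
by rewrite /= mevalZ mevalXU mxE mulrC.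
Qed.

Lemma mlform_homog M (a : 'cV[F]_M) : mlform a \is 1.-homog.
Proof. by apply: rpred_sum => i _; apply: dhomogZ; rewrite dhomogX /= mdeg1. Qed.

Lemma prod_mlform_homog M (s : seq 'cV[F]_M) : \prod_(a <- s) mlform a \is (size s).-homog.
Proof.
elim: s => [|a s IHs]; first by rewrite big_nil dhomog1.
by rewrite big_cons; apply: (dhomogM (d := 1)) => //; apply: mlform_homog.
Qed.

Lemma mlform_neq0 M (a : 'cV[F]_M) : a != 0 -> mlform a != 0.
Proof.
case/lform_eq1 => e ae; apply/eqP => l0.
have := meval_mlform a (e 0); rewrite l0 meval0.
have -> : \row_i e 0 i = e by apply/rowP => i; rewrite mxE.
by rewrite ae => /eqP; rewrite eq_sym oner_eq0.
Qed.

Lemma mpoly_prod_lform m (f : {mpoly F[m.+1]}) c (s : seq 'cV[F]_m.+1) :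
  f \is (size s).-homog -> (size s <= q)%N -> f != 0 -> {in s, forall a, a != 0} ->
  (forall x, mfun f x = c * \prod_(a <- s) lform a x) -> union_of_Fq_hyperplanes f.
Proof.
move=> f_homog le_sq f_neq0 s_neq0 fE.
have fE' : f = c *: \prod_(a <- s) mlform a.
  apply/eqP; rewrite -subr_eq0; apply/eqP; apply: dhomog_eq0 le_sq _.
    by rewrite rpredB // dhomogZ // prod_mlform_homog.
  move=> v; rewrite mevalB mevalZ rmorph_prod /=.
  have -> : f.@[v] = mfun f (\row_i v i) by apply: meval_eq => i; rewrite mxE.
  rewrite fE; apply/eqP; rewrite subr_eq0; apply/eqP; congr (_ * _).
  by apply: eq_bigr => a _; rewrite meval_mlform.
exists c, [seq mlform a | a <- s]; split; [|split].
- by apply: contraNneq f_neq0 => c0; rewrite fE' c0 scale0r.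
- apply/allP => _ /mapP[a as_ ->]; rewrite mlform_homog andbT.
  by apply/mlform_neq0/s_neq0.
- by rewrite big_map.
Qed.

(** The nonzero zeros split into classes of q - 1 scalar multiples; the positive degree makes the
    origin a zero as well. *)
Lemma card_rat_points m d (f : {mpoly F[m.+1]}) : f \is d.+1.-homog ->
  (#|rat_points f| * q.-1 + 1 = zeros (mfun f))%N.
Proof.
move=> f_homog; have Hf := homfun_mfun f_homog.
pose tor (x : vecs F m) : 'rV[F]_m.+1 := \row_i x i.
have torE (x : vecs F m) : f.@[x] = mfun f (tor x) by apply: meval_eq => i; rewrite mxE.
have fZ c (x : vecs F m) : f.@[scalev c x] = c ^+ d.+1 * f.@[x].
  by rewrite !torE -(homfunZ c _ Hf); congr mfun; apply/rowP => i; rewrite !mxE !ffunE.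
have -> : zeros (mfun f) = #|[set x : vecs F m | f.@[x] == 0]|.
  have tor_inj : injective tor.
    by move=> x y /rowP xy; apply/ffunP => i; have := xy i; rewrite !mxE.
  rewrite -(card_imset _ tor_inj); apply: eq_card => x; rewrite inE.
  apply/eqP/imsetP => [fx|[y]]; last by rewrite inE torE => /eqP fy ->.
  exists [ffun i => x 0 i]; last by apply/rowP => i; rewrite !mxE ffunE.
  rewrite inE torE; apply/eqP; rewrite -[RHS]fx; congr mfun.
  by apply/rowP => i; rewrite mxE ffunE.
have f0 : f.@[(0 : vecs F m)] = 0.
  by rewrite torE -(homfun_at0 Hf); congr mfun; apply/rowP => i; rewrite !mxE ffunE.
rewrite [in RHS](cardsD1 (0 : vecs F m)) inE f0 eqxx addnC; congr (_ + _)%N.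
have class_neq0 (x : vecs F m) c : c != 0 -> x != 0 -> scalev c x != 0.
  move=> c0; apply: contraNneq => cx; apply/eqP/ffunP => i.
  have := congr1 (fun z : vecs F m => z i) cx; rewrite !ffunE => /eqP.
  by rewrite mulf_eq0 (negPf c0) => /eqP->.
have scale1 (x : vecs F m) : scalev 1 x = x by apply/ffunP => i; rewrite ffunE mul1r.
have scaleA c e (x : vecs F m) : scalev c (scalev e x) = scalev (c * e) x.
  by apply/ffunP => i; rewrite !ffunE mulrA.
have class_scale (x : vecs F m) c : c != 0 -> proj_class (scalev c x) = proj_class x.
  move=> c0; apply/setP => y; apply/imsetP/imsetP => -[e].
    rewrite inE => e0 ->; exists (e * c); first by rewrite inE mulf_neq0.
    by rewrite scaleA.
  rewrite inE => e0 ->; exists (e / c); first by rewrite inE mulf_neq0 ?invr_eq0.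
  by rewrite scaleA divfK.
apply/esym; apply: card_uniform_partition.
- move=> P; rewrite inE => /andP[/imsetP[x]]; rewrite inE => x0 -> _.
  rewrite card_in_imset; last first.
    move=> c e _ _ /ffunP ce; have /existsP[i xi] : [exists i, x i != 0].
      apply: contraNT x0 => /existsPn xn; apply/eqP/ffunP => i; rewrite ffunE.
      exact/eqP/negPn/xn.
    by have := ce i; rewrite !ffunE => /(mulIf xi).
  have := cardsC1 (0 : F); rewrite /= => <-; apply: eq_card => c; by rewrite !inE.
- apply/and3P; split.
  + apply/eqP/setP => x; rewrite !inE; apply/bigcupP/andP => [[P]|[x0 fx]].
      rewrite inE => /andP[/imsetP[y]]; rewrite inE => y0 -> /forallP fP xP.
      split; last by have := fP x; rewrite xP.
      by move: xP => /imsetP[c]; rewrite inE => c0 ->; apply: class_neq0.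
    exists (proj_class x); last by apply/imsetP; exists 1; rewrite ?inE ?oner_eq0.
    rewrite inE; apply/andP; split; first by apply/imsetP; exists x; rewrite ?inE.
    apply/forallP => y; apply/implyP => /imsetP[c _ ->].
    by rewrite fZ (eqP fx) mulr0.
  + apply/trivIsetP => P P'; rewrite !inE => /andP[/imsetP[x _ ->] _] /andP[/imsetP[y _ ->] _].
    apply: contraR => /pred0Pn[z /andP[/= /imsetP[c + zc] /imsetP[e + ze]]].
    rewrite !inE => c0 e0; rewrite -(class_scale x c c0) -(class_scale y e e0) -zc -ze.
    by apply/eqP.
  + apply/negP; rewrite inE => /andP[/imsetP[x _]] /setP/(_ x).
    by rewrite inE => /esym/negP[]; apply/imsetP; exists 1; rewrite ?inE ?oner_eq0.
Qed.
End RationalPoints.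

(** * The case of a zero on no hyperplane of the zero set *)

Section OffHyperplanes.
Variable F : finFieldType.
Local Notation q := #|F|.

(** Take U of maximal rank among the subspaces of the zero set through [x0]. If f vanished on a
    coset U + v, homogeneity would make it vanish on U + <v>, so v would lie in U. *)
Lemma exists_maximal_subspace M d (f : 'rV[F]_M -> F) x0 :
  homfun d f -> (exists x, f x != 0) -> f x0 = 0 -> x0 != 0 ->
  (forall a, a != 0 -> lform a x0 = 0 -> exists2 x, lform a x = 0 & f x != 0) ->
  exists k (B : 'M[F]_(k, M)),
  [/\ (0 < k)%N, (k.+1 < M)%N, row_free B, forall y, f (y *m B) = 0
    & forall v, ~~ (v <= B)%MS -> exists y, f (y *m B + v) != 0].
Proof.
move=> Hf [x1 fx1] fx0 x0_neq0 x0_hyp.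
pose ok (U : 'M[F]_M) := (x0 <= U)%MS && [forall x : 'rV_M, (x <= U)%MS ==> (f x == 0)].
have ok0 : ok <<x0>>%MS.
  rewrite /ok genmxE submx_refl; apply/forallP => x; apply/implyP.
  rewrite genmxE => /sub_rVP[t ->].
  by rewrite (homfunZ t x0 Hf) fx0 mulr0.
case: (@arg_maxnP _ _ ok (fun U => \rank U) ok0) => U /andP[x0U /forallP fU] maxU.
have f0 x : (x <= U)%MS -> f x = 0 by move=> xU; have := fU x; rewrite xU => /eqP.
have U_nfull : ~~ row_full U.
  by apply: contra fx1 => fullU; rewrite f0 // submx_full.
exists (\rank U), (row_base U); split.
- by rewrite lt0n mxrank_eq0; apply: contraNneq x0_neq0 => U0; rewrite -submx0 -U0.
- have lt_rk : (\rank U < M)%N by rewrite ltn_neqAle rank_leq_col andbT.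
  rewrite ltn_neqAle lt_rk andbT; apply/eqP => rkU.
  (* Were U of codimension 1, it would be the kernel of a nonzero column of its cokernel matrix: a
     hyperplane through [x0] on which f vanishes. *)
  have : cokermx U != 0 by rewrite -mxrank_eq0 mxrank_coker -lt0n subn_gt0.
  case/matrix0Pn => i [j nz].
  have a_neq0 : col j (cokermx U) != 0.
    by apply: contraNneq nz => /colP/(_ i); rewrite !mxE => ->.
  have Ua : (U <= kermx (col j (cokermx U)))%MS.
    by apply/sub_kermxP; rewrite colE mulmxA mulmx_coker mul0mx.
  have aU : (kermx (col j (cokermx U)) <= U)%MS.
    rewrite -(geq_leqif (mxrank_leqif_sup Ua)) mxrank_ker.
    have : (0 < \rank (col j (cokermx U)))%N by rewrite lt0n mxrank_eq0.
    by move: (\rank (col _ _)) rkU; lia.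
  have [|x ax /eqP[]] := x0_hyp _ a_neq0.
    by apply/eqP; rewrite lform_kermx (submx_trans x0U).
  by apply: f0; apply: submx_trans aU; rewrite -lform_kermx ax.
- exact: row_base_free.
- by move=> y; apply: f0; rewrite (submx_trans (submxMl _ _)) // eq_row_base.
move=> v; rewrite eq_row_base => vU; apply/existsP; apply: contraT => /existsPn fv.
have fUv (u : 'rV_M) : (u <= U)%MS -> f (u + v) = 0.
  rewrite -(eq_row_base U) => /submxP[y ->]; exact/eqP/negPn/fv.
have okUv : ok (U + v)%MS.
  apply/andP; split; first exact: submx_trans x0U (addsmxSl _ _).
  apply/forallP => x; apply/implyP => /sub_addsmxP[[u1 u2] /= ->].
  rewrite [u2]mx11_scalar mul_scalar_mx; move: (u2 0 0) => t.
  have uU : (u1 *m U <= U)%MS by apply: submxMl.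
  have [->|t_neq0] := eqVneq t 0; first by rewrite scale0r addr0 f0.
  have -> : u1 *m U + t *: v = t *: (t^-1 *: (u1 *m U) + v).
    by rewrite scalerDr scalerA divff // scale1r.
  by rewrite (homfunZ _ _ Hf) fUv ?mulr0 // scalemx_sub.
case/negP: vU; have /= := maxU _ okUv.
by rewrite (geq_leqif (mxrank_leqif_sup (addsmxSl U v))) addsmx_sub => /andP[].
Qed.

Lemma zeros_off_hyperplanes_le E m n (f : 'rV[F]_m.+1 -> F) x0 :
  E = (q ^ (m - 3))%N -> (3 <= m)%N -> (0 < n)%N -> (n < q)%N ->
  homfun n.+1 f -> (exists x, f x != 0) -> f x0 = 0 -> x0 != 0 ->
  (forall a, a != 0 -> lform a x0 = 0 -> exists2 x, lform a x = 0 & f x != 0) ->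
  (zeros f + n * (q * E) <= q ^ 2 * E + n * (q ^ 3 * E))%N /\
  ((q < 2 * n)%N ->
   zeros f + n.-1 * (q * E) + n * (q * E) <= n * (q ^ 3 * E) + q ^ 2 * E + n.-1 * E)%N.
Proof.
move=> EE m_ge3 n_gt0 lt_nq Hf f_neq0 fx0 x0_neq0 x0_hyp.
have [k [B [k_gt0 lt_kM freeB f0 maxB]]] := exists_maximal_subspace Hf f_neq0 fx0 x0_neq0 x0_hyp.
have q_gt0 : (0 < q)%N by apply: leq_ltn_trans lt_nq.
have qE i : (q ^ (m - 3 + i) = q ^ i * E)%N by rewrite EE expnD mulnC.
have le_k : (q ^ k <= q ^ 2 * E)%N.
  by rewrite -qE leq_exp2l ?(leq_ltn_trans _ lt_nq) //; lia.
have E_gt0 : (0 < E)%N by rewrite EE expn_gt0 q_gt0.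
have qm1 : (q ^ m.+1 = q ^ 4 * E)%N by rewrite -qE; congr (_ ^ _)%N; lia.
split=> [|lt_q2n].
  (* Here q^k enters the bound with coefficient q - n > 0, so the worst case is codimension 2, that
     is k = m - 1. *)
  have := zeros_maximal_le Hf n_gt0 lt_nq freeB f0 maxB (ltnW (ltnW lt_kM)).
  rewrite qm1 expnS; have := leq_mul (leqnn (q - n)) le_k.
  have [j ->] : exists j, q = (n + j)%N by exists (q - n)%N; lia.
  rewrite addKn; move: (_ ^ k)%N (zeros f) => K z H1 H2.
  rewrite -(@leq_pmul2l (n + j)%N); last by lia.
  by move: H1 H2; rewrite !expnS expn0 !muln1; clear; nia.
have := zeros_maximal_defect_le Hf n_gt0 lt_nq freeB f0 maxB lt_q2n (ltnW lt_kM).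
have qm2 : (q ^ m.+2 = q ^ 5 * E)%N by rewrite -qE; congr (_ ^ _)%N; lia.
have qm : (q ^ m = q ^ 3 * E)%N by rewrite -qE; congr (_ ^ _)%N; lia.
have le_km : (q ^ k <= q ^ m)%N.
  by rewrite leq_exp2l ?(leq_ltn_trans _ lt_nq) //; lia.
rewrite [m.+1.-1]/= qm2 (expnS q k) (expnS q k.+1) (expnS q k).
(* Now the coefficient of q^k is q^2 - n q + n - 1 = (q - 1)(q - n + 1). *)
move=> H1; have H2 := leq_mul (leqnn (q.-1 * (q - n.-1))%N) le_k.
rewrite -(@leq_pmul2l (q ^ 2)%N) ?expn_gt0 ?q_gt0 //.
move: H1 H2; rewrite mulnBl qm.
have : (q ^ k * n.-1 <= q ^ 3 * E * n.-1)%N by rewrite -qm leq_mul2r le_km orbT.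
case: n n_gt0 lt_nq {Hf lt_q2n} => // l _ lt_lq.
have [j ->] : exists j, q = (l + j).+2%N by exists (q - l.+2)%N; lia.
have -> : ((l + j).+2 - l.+1.-1 = j.+2)%N by lia.
rewrite !expnS expn0 !muln1 /=; move: (_ ^ k)%N (zeros f) => K z; clear.
nia.
Qed.
End OffHyperplanes.

(** * Arithmetic of the bounds *)

(* Throughout, q is the order of the field, n = d - 1, E = q ^ (m - 3), and Z is
   the number of zeros in the affine cone. *)

Lemma bound_a_lt_of_maximal q E n Z : (n.+1 < q)%N -> (2 * n <= q)%N -> (0 < n)%N -> (0 < E)%N ->
  (Z + n * (q * E) <= q ^ 2 * E + n * (q ^ 3 * E))%N ->
  (Z + q.-1 * (n.-1 * (q * E)) < q.-1 * (n.+1 * (q ^ 2 * E)) + q ^ 2 * E)%N.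
Proof.
case: q n => [//|r] [//|l] /= H1 H2 _ E0.
have [j ->] : exists j, r = (l + l + j + 1)%N by exists (r - (l + l + 1))%N; lia.
by rewrite !expnS expn0; nia.
Qed.

(** Expanding the products shows that both inequalities bound Z by the same number. *)
Lemma bound_b_of_defect q E n Z : (n < q)%N -> (0 < n)%N ->
  (Z + n.-1 * (q * E) + n * (q * E) <= n * (q ^ 3 * E) + q ^ 2 * E + n.-1 * E)%N ->
  (Z + q.-1 * (n.-1 * E) <= q.-1 * (n * (q ^ 2 * E) + n.+1 * (q * E)) + q * E)%N.
Proof.
case: q n => [//|r] [//|l] /= H1 _.
rewrite !expnS expn0; nia.
Qed.

(** The hypotheses force q = 2n - 1, that is d = (q + 3)/2; there the first-part bound on Z exceeds
    the second-part bound by (q - 1)(n - 1) E. *)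
Lemma bound_a_lt_of_bound_b q E n Z : (q < 2 * n)%N -> (2 * n.+1 <= q + 3)%N -> (1 < n)%N -> (0 < E)%N ->
  (Z + q.-1 * (n.-1 * E) <= q.-1 * (n * (q ^ 2 * E) + n.+1 * (q * E)) + q * E)%N ->
  (Z + q.-1 * (n.-1 * (q * E)) < q.-1 * (n.+1 * (q ^ 2 * E)) + q ^ 2 * E)%N.
Proof.
move=> H1 H2 n1 E0; have -> : n = (n - 2).+2 by lia.
have -> : q = (n - 2 + (n - 2)).+3 by lia.
by move: (n - 2)%N => l; rewrite /= !expnS expn0; nia.
Qed.

Lemma bounds_of_few_hyperplanes q E n Z : (n < q)%N -> (0 < n)%N -> (0 < E)%N ->
  (Z + n.-1 * (q ^ 2 * E) <= n * (q ^ 3 * E))%N ->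
  (Z + q.-1 * (n.-1 * (q * E)) < q.-1 * (n.+1 * (q ^ 2 * E)) + q ^ 2 * E)%N /\
  (Z + q.-1 * (n.-1 * E) <= q.-1 * (n * (q ^ 2 * E) + n.+1 * (q * E)) + q * E)%N.
Proof.
case: q n => [//|r] [//|l] /= H1 _ E0.
have [j ->] : exists j, r = (l + j + 1)%N by exists (r - (l + 1))%N; lia.
rewrite !expnS expn0 => H; split; nia.
Qed.

(** The first-part bound minus the second-part bound is (q - 1) E (q (q - 2n + 1) + n - 1), which is
    negative once q <= 2n - 2. *)
Lemma bound_b_of_bound_a q E n Z : (n < q)%N -> (0 < n)%N -> (q + 3 < 2 * n.+1)%N ->
  (Z + q.-1 * (n.-1 * (q * E)) <= q.-1 * (n.+1 * (q ^ 2 * E)) + q ^ 2 * E)%N ->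
  (Z + q.-1 * (n.-1 * E) <= q.-1 * (n * (q ^ 2 * E) + n.+1 * (q * E)) + q * E)%N.
Proof.
move=> H1 n0 H2.
have [i [j [-> ->]]] : exists i j, q = (i + i + j).+4 /\ n = (i + j).+3.
  by exists (q - n.+1)%N, (2 * n - q - 2)%N; lia.
by rewrite /= !expnS expn0; nia.
Qed.

(** Division by q^2 gives exactly the required bound, with l = d - 2. *)
Lemma bound_a_of_arrangement q E l Z : (0 < q)%N ->
  (q ^ 2 * Z <= q ^ 5 * E + (q ^ 4 * E - q ^ 3 * E) * (l.+1 * q - l))%N ->
  (Z + q.-1 * (l * (q * E)) <= q.-1 * (l.+2 * (q ^ 2 * E)) + q ^ 2 * E)%N.
Proof.
case: q => // r _.
have -> : (l.+1 * r.+1 - l = l * r + r.+1)%N by lia.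
have -> : (r.+1 ^ 4 * E - r.+1 ^ 3 * E = r * (r.+1 ^ 3 * E))%N.
  by rewrite (expnS _ 3) -mulnA mulSn addKn.
have -> : (r.+1 ^ 5 * E + r * (r.+1 ^ 3 * E) * (l * r + r.+1)
    = r.+1 ^ 2 * (r.+1 ^ 3 * E + r * (r.+1 * E) * (l * r + r.+1)))%N.
  by rewrite (expnD _ 2 3) (expnD _ 2 1) expn1; lia.
rewrite leq_pmul2l ?expn_gt0 // !expnS expn0 => /leq_add H.
by apply: leq_trans (H _ _ (leqnn _)) _; rewrite /=; lia.
Qed.

(** Passage from the cone to projective points: r is q - 1, p is one of the p_k, and X is the power
    q^(k+1). *)
Lemma cone_count_le N r p A Y X : (0 < r)%N -> (p * r + 1 = X)%N ->
  (N * r + 1 + r * Y <= r * A + X)%N -> (N <= A + p - Y)%N.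
Proof.
move=> r_gt0 <- H; rewrite leq_subRL; last first.
  by rewrite -(leq_pmul2l r_gt0); lia.
by rewrite -(leq_pmul2l r_gt0); lia.
Qed.

Lemma cone_count_neq N r p A Y X : (p * r + 1 = X)%N -> (Y <= A)%N ->
  (N * r + 1 + r * Y < r * A + X)%N -> N <> (A + p - Y)%N.
Proof.
move=> <- leYA H NE; have /(congr1 (muln r)) : (A + p = N + Y)%N by lia.
by rewrite !mulnDr; move: H; lia.
Qed.

Lemma pk_geometric r j : (0 < r)%N -> (pk r j * r.-1 + 1 = r ^ j.+1)%N.
Proof.
by move=> r_gt0; rewrite mulnC /pk -predn_exp addn1 prednK // expn_gt0 r_gt0.
Qed.

(** * Hypersurfaces *)

Section Hypersurfaces.
Variable F : finFieldType.
Local Notation q := #|F|.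

Lemma mfun_neq0 M d (f : {mpoly F[M]}) : f \is d.-homog -> (d <= q)%N -> f != 0 ->
  exists x, mfun f x != 0.
Proof.
move=> f_homog le_dq f_neq0; apply/existsP; apply: contraNT f_neq0 => /existsPn f0.
apply/eqP; apply: dhomog_eq0 f_homog le_dq _ => v.
have -> : f.@[v] = mfun f (\row_i v i) by apply: meval_eq => i; rewrite mxE.
exact/eqP/negPn/f0.
Qed.

(* The bounds of the theorem for Z = 1 + (q - 1) N, subtractions moved to the left. *)
Definition bound_a E n Z :=
  (Z + q.-1 * (n.-1 * (q * E)) <= q.-1 * (n.+1 * (q ^ 2 * E)) + q ^ 2 * E)%N.

Definition bound_a_strict E n Z :=
  (Z + q.-1 * (n.-1 * (q * E)) < q.-1 * (n.+1 * (q ^ 2 * E)) + q ^ 2 * E)%N.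

Definition bound_b E n Z :=
  (Z + q.-1 * (n.-1 * E) <= q.-1 * (n * (q ^ 2 * E) + n.+1 * (q * E)) + q * E)%N.

Lemma zeros_hunion_le m n (f : 'rV[F]_m.+1 -> F) (s : seq 'cV_m.+1) E :
  E = (q ^ (m - 3))%N -> (3 <= m)%N -> (0 < n)%N -> (size s <= n)%N ->
  {in s, forall a, a != 0} -> (forall x, f x = 0 -> x != 0 -> x \in hunion s) ->
  (zeros f + n.-1 * (q ^ 2 * E) <= n * (q ^ 3 * E))%N.
Proof.
move=> EE m_ge3 n_gt0 le_sn s_neq0 fs.
have q_gt1 : (1 < q)%N := finNzRing_gt1 F.
have qE i : (q ^ (m - 3 + i) = q ^ i * E)%N by rewrite EE expnD mulnC.
have qm : (q ^ m = q ^ 3 * E)%N by rewrite -qE; congr (_ ^ _)%N; lia.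
have qm1 : (q ^ (m.+1 - 2) = q ^ 2 * E)%N by rewrite -qE; congr (_ ^ _)%N; lia.
have le_q23 : (q ^ 2 * E <= q ^ 3 * E)%N by rewrite leq_mul2r leq_exp2l ?orbT.
(* The origin is added because [hunion s] is empty when [s] is. *)
have sub0 : [set x | f x == 0] \subset 0 |: hunion s.
  apply/subsetP => x; rewrite inE in_setU1 => /eqP fx.
  by have [//|/(fs x fx)->] := eqVneq x 0; rewrite orbT.
have leZ : (zeros f <= q ^ 3 * E + n.-1 * (q ^ 3 * E - q ^ 2 * E))%N.
  apply: leq_trans (subset_leq_card sub0) _.
  case: s s_neq0 le_sn {fs sub0} => [|a s] s_neq0 le_sn.
    rewrite (_ : hunion [::] = set0) ?setU0 ?cards1 -?qm; last by apply/setP => x; rewrite !inE.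
    by rewrite (leq_trans _ (leq_addr _ _)) // expn_gt0 ltnW.
  have -> : 0 |: hunion (a :: s) = hunion (a :: s).
    by apply/setUidPr; rewrite sub1set !inE /= /lform mul0mx mxE eqxx.
  apply: leq_trans (card_hunion_le s_neq0) _.
  by rewrite /= qm qm1 leq_add2l leq_mul2r -ltnS prednK // le_sn orbT.
apply: leq_trans (leq_add leZ (leqnn _)) _.
case: n n_gt0 {le_sn leZ} => // l _ /=.
by rewrite -addnA -mulnDr subnK // mulSn.
Qed.

Lemma zeros_product m d (f : {mpoly F[m.+1]}) (s : seq 'cV_m.+1) E :
  E = (q ^ (m - 3))%N -> (3 <= m)%N -> (3 <= d)%N -> (d <= q)%N -> f \is d.-homog -> f != 0 ->
  size s = d -> pairwise (@hyp_diff F m.+1) s ->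
  {in s, forall a, a != 0 /\ forall x, lform a x = 0 -> mfun f x = 0} ->
  (zeros (mfun f) < q.-1 * (d * (q ^ 2 * E)) + q ^ 2 * E)%N ->
  bound_a E d.-1 (zeros (mfun f)) /\ union_of_Fq_hyperplanes f.
Proof.
move=> EE m_ge3 d_ge3 le_dq f_homog f_neq0 sd diff_s sf lt_max.
have q_gt1 : (1 < q)%N := finNzRing_gt1 F.
have qE i : (q ^ (m - 3 + i) = q ^ i * E)%N by rewrite EE expnD mulnC.
have qm : (q ^ m = q ^ 3 * E)%N by rewrite -qE; congr (_ ^ _)%N; lia.
have qm1 : (q ^ (m.+1 - 2) = q ^ 2 * E)%N by rewrite -qE; congr (_ ^ _)%N; lia.
have qm2 : (q ^ m.+2 = q ^ 5 * E)%N by rewrite -qE; congr (_ ^ _)%N; lia.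
have qm3 : (q ^ m.+1 = q ^ 4 * E)%N by rewrite -qE; congr (_ ^ _)%N; lia.
have exf := mfun_neq0 f_homog le_dq f_neq0.
have s_neq0 : {in s, forall a, a != 0} by move=> a /sf[].
(* The d forms use up the whole degree, so the cofactor has degree 0 and is a constant. *)
have Hf : homfun (size s + 0) (mfun f) by rewrite addn0 sd; apply: homfun_mfun.
have [|g Hg fE'] := homfun_factor_seq Hf _ sf diff_s; first by rewrite addn0 sd.
have {fE' Hg}fE x : mfun f x = g 0 * \prod_(a <- s) lform a x.
  by rewrite fE' (homfun0_const x Hg) mulrC.
split; last by apply: mpoly_prod_lform fE => //; rewrite sd.
case: s sd diff_s sf s_neq0 fE {Hf} => [|a [|b s]] sd diff_s sf s_neq0 fE;
  [by rewrite -sd in d_ge3 | by rewrite -sd in d_ge3 | ].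
have [a_neq0 fa] := sf a (mem_head _ _).
have b_in : b \in [:: a, b & s] by rewrite !inE eqxx orbT.
have [b_neq0 fb] := sf b b_in.
pose T := hplane a :&: hplane b.
have diff_ab : hyp_diff a b by case/andP: diff_s => /andP[].
(* If all d hyperplanes contain [T], they have at least q^(m-1) + d (q^m - q^(m-1)) points, the
   number that [lt_max] excludes. *)
have [allT|] := boolP (all (fun e => T \subset hplane e) s).
  have cT : #|T| = (q ^ (m.+1 - 2))%N by apply: card_hplaneI.
  have inT : {in [:: a, b & s], forall e, e != 0 /\ T \subset hplane e}.
    move=> e e_in; split; first exact: s_neq0.
    move: e_in; rewrite !inE => /or3P[/eqP->|/eqP->|es]; [exact: subsetIl|exact: subsetIr|].
    exact: (allP allT).
  have := card_hunion_pencil_ge inT diff_s cT; rewrite sd qm1 [m.+1.-1]/= qm => leZ.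
  have subZ : T :|: hunion [:: a, b & s] \subset [set x | mfun f x == 0].
    apply/subsetP => x; rewrite in_setU => /orP[|].
      by rewrite !inE => /andP[/eqP ax _]; rewrite fa.
    by rewrite [x \in hunion _]inE inE => /hasP[e e_in /eqP ex]; have [_ ->] := sf e e_in.
  move: lt_max (leq_trans leZ (subset_leq_card subZ)); rewrite -/(zeros _).
  rewrite [in X in X -> _]mulnCA.
  have -> : (q ^ 3 * E - q ^ 2 * E = q.-1 * (q ^ 2 * E))%N.
    by rewrite (expnS q 2) -{1}(prednK (ltnW q_gt1)) -mulnA mulSn addKn.
  by rewrite addnC ltnNge => /negPf->.
case/allPn => e es /subsetPn[P]; rewrite !inE => /andP[/eqP aP /eqP bP] eP.
have sd' : (size s).+2 = d by [].
have lt_sq : ((size s).+1 < q)%N by rewrite sd'.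
have := zeros_arrangement_le fE exf a_neq0 (ltnW lt_sq) isT aP bP es eP.
rewrite [m.+1.-1]/= qm2 qm3 qm /bound_a -sd' /= => leZ.
exact: bound_a_of_arrangement (ltnW q_gt1) leZ.
Qed.

Lemma zeros_trichotomy m d (f : {mpoly F[m.+1]}) E :
  E = (q ^ (m - 3))%N -> (3 <= m)%N -> (3 <= d)%N -> (d <= q)%N -> f \is d.-homog -> f != 0 ->
  (zeros (mfun f) < q.-1 * (d * (q ^ 2 * E)) + q ^ 2 * E)%N ->
  ((2 * d <= q + 3)%N ->
    bound_a_strict E d.-1 (zeros (mfun f)) \/
    bound_a E d.-1 (zeros (mfun f)) /\ union_of_Fq_hyperplanes f) /\
  ((q + 3 < 2 * d)%N -> bound_b E d.-1 (zeros (mfun f))).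
Proof.
move=> EE m_ge3 d_ge3 le_dq f_homog f_neq0 lt_max.
have E_gt0 : (0 < E)%N by rewrite EE expn_gt0 ltnW // finNzRing_gt1.
have [s [sf diff_s [sd|[lt_sd cov]]]] := hplane_family (mfun f) d.
  have [boundA unionf] := zeros_product EE m_ge3 d_ge3 le_dq f_homog f_neq0 sd diff_s sf lt_max.
  split=> [_|lt_q2d]; first by right.
  by apply: bound_b_of_bound_a boundA; lia.
case: d d_ge3 le_dq f_homog lt_max lt_sd cov => // n d_ge3 lt_nq f_homog lt_max lt_sd cov.
have n_gt0 : (0 < n)%N by apply: ltnW.
pose covered x := [exists a : 'cV_m.+1, [&& a != 0, lform a x == 0
  & [forall y, (lform a y == 0) ==> (mfun f y == 0)]]].
have [/forallP allc|/forallPn[x0]] := boolP [forall x, (mfun f x == 0) && (x != 0) ==> covered x].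
  have leZ : (zeros (mfun f) + n.-1 * (q ^ 2 * E) <= n * (q ^ 3 * E))%N.
    apply: (zeros_hunion_le EE m_ge3 n_gt0 lt_sd) => [a /sf[]//|x fx x_neq0].
    have := allc x; rewrite fx eqxx x_neq0 /= => /existsP[a /and3P[a_neq0 /eqP ax /forallP fa]].
    by apply: (cov a x a_neq0 _ ax) => y ay; have := fa y; rewrite ay eqxx => /eqP.
  have [sA sB] := bounds_of_few_hyperplanes lt_nq n_gt0 E_gt0 leZ.
  by split=> [_|_]; [left | ].
rewrite negb_imply => /andP[/andP[/eqP fx0 x0_neq0] /existsPn ncov].
have x0_hyp a : a != 0 -> lform a x0 = 0 -> exists2 x, lform a x = 0 & mfun f x != 0.
  move=> a_neq0 ax0; have := ncov a; rewrite a_neq0 ax0 eqxx /= => /forallPn[x].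
  by rewrite negb_imply => /andP[/eqP ax fx]; exists x.
have [HK defect] := zeros_off_hyperplanes_le EE m_ge3 n_gt0 lt_nq (homfun_mfun f_homog)
  (mfun_neq0 f_homog lt_nq f_neq0) fx0 x0_neq0 x0_hyp.
split=> [le_2d|lt_q2d]; last by apply: bound_b_of_defect (defect _) => //; lia.
left; have [le_2n|lt_q2n] := leqP (2 * n) q; first by apply: bound_a_lt_of_maximal HK => //; lia.
by apply: bound_a_lt_of_bound_b (bound_b_of_defect lt_nq n_gt0 (defect lt_q2n)).
Qed.
End Hypersurfaces.

Local Close Scope ring_scope.

Theorem theorem3p6 (F : finFieldType) (q d m : nat) (f : {mpoly F[m.+1]}) :
  #|F| = q -> (3 <= q)%N -> (3 <= d)%N -> (3 <= m)%N ->
  hypersurface d f ->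
  (#|rat_points f| < d * q ^ (m - 1) + pk q (m - 2))%N ->
  ((2 * d <= q + 3)%N ->
     (#|rat_points f| <= d * q ^ (m - 1) + pk q (m - 2) - (d - 2) * q ^ (m - 2))%N /\
     (#|rat_points f| = d * q ^ (m - 1) + pk q (m - 2) - (d - 2) * q ^ (m - 2) ->
        union_of_Fq_hyperplanes f)) /\
  ((q + 3 < 2 * d)%N -> (d <= q)%N ->
     (#|rat_points f| <= (d - 1) * q ^ (m - 1) + d * q ^ (m - 2) + pk q (m - 3)
                          - (d - 2) * q ^ (m - 3))%N).
Proof.
move=> qE q_ge3 d_ge3 m_ge3 [f_neq0 f_homog] lt_max.
(* For d > q both parts are void: 2d <= q + 3 would force q <= 1. *)
have [le_dq|lt_qd] := leqP d q; last by split=> [|_]; lia.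
pose E := (q ^ (m - 3))%N.
have qm1 : (q ^ (m - 1) = q ^ 2 * E)%N by rewrite -expnD; congr (_ ^ _)%N; lia.
have qm2 : (q ^ (m - 2) = q * E)%N by rewrite -expnS; congr (_ ^ _)%N; lia.
have q_gt0 : (0 < q)%N by lia.
have pk2 : (pk q (m - 2) * q.-1 + 1 = q ^ 2 * E)%N.
  by rewrite pk_geometric // -qm1; congr (_ ^ _)%N; lia.
have pk3 : (pk q (m - 3) * q.-1 + 1 = q * E)%N.
  by rewrite pk_geometric // -qm2; congr (_ ^ _)%N; lia.
have ZE : (#|rat_points f| * q.-1 + 1 = zeros (mfun f))%N.
  by rewrite -qE; apply: (@card_rat_points _ _ d.-1); rewrite prednK // (ltnW (ltnW d_ge3)).
have := @zeros_trichotomy F m d f E.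
rewrite /bound_a /bound_a_strict /bound_b qE qm1 qm2 -/E -ZE.
move: lt_max; rewrite qm1; move: #|rat_points f| => N lt_max.
move: pk2 pk3; move: (pk q (m - 2)) (pk q (m - 3)) lt_max => p2 p3 lt_max pk2 pk3.
have [r_gt0 d1 d2 d3] : [/\ (0 < q.-1)%N, d.-1.-1 = (d - 2)%N, d.-1.+1 = d & d.-1 = (d - 1)%N].
  by split; lia.
have lt_Z : (N * q.-1 + 1 < q.-1 * (d * (q ^ 2 * E)) + q ^ 2 * E)%N.
  by move: lt_max pk2 r_gt0; move: (q ^ 2 * E)%N q.-1 => X r; clear; nia.
move=> /(_ erefl m_ge3 d_ge3 le_dq f_homog f_neq0 lt_Z)[boundA boundB].
rewrite d1 d2 in boundA; rewrite d1 d2 d3 in boundB; split=> [le_2d|lt_2d _].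
  (* This ensures that the subtraction in the bound does not truncate when equality is excluded. *)
  have leYX : ((d - 2) * (q * E) <= d * (q ^ 2 * E))%N.
    by rewrite leq_mul ?leq_subr // leq_mul2r expnS leq_pmulr ?expn_gt0 ?q_gt0 ?orbT.
  case: (boundA le_2d) => [lt_A|[le_A unionf]].
    split; first exact: cone_count_le r_gt0 pk2 (ltnW lt_A).
    by move=> NE; case: (cone_count_neq pk2 leYX lt_A NE).
  by split; first exact: cone_count_le r_gt0 pk2 le_A.
exact: cone_count_le r_gt0 pk3 (boundB lt_2d).
Qed.
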